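(* Let $a,b\in\mathbb{Q}$ be fixed, and consider the invariants $p_{sc}$, $p_{lk}$ and $p_{lk,L}$ of oriented virtual tangles with ordered components. Then each of the linking number polynomials $p_{lk}$ and $p_{lk,L}$ is stronger than the self-crossing polynomial $p_{sc}$. Moreover, the Laurent polynomial $p_{lk,L}$ is stronger than $p_{lk}$.
   Context: **Stronger.** An invariant $A$ is stronger than an invariant $B$ if whenever $A(K)=A(K')$ we also have $B(K)=B(K')$, and there is a pair of tangles $T_1,T_2$ with $B(T_1)=B(T_2)$ but $A(T_1)\neq A(T_2)$. **Virtual tangles.** A virtual tangle diagram is a generic immersion in a square of finitely many circles (closed components) and intervals (long components); the endpoints of the long components are fixed distinguished points on the top or bottom side of the square. Each transverse double point of the immersion is marked either as a classical crossing (with over/under information) or as a virtual crossing. Long components need not connect top to bottom, and the numbers of endpoints at top and bottom may differ. A virtual tangle is an equivalence class of such diagrams under planar isotopy (fixing endpoints), the classical Reidemeister moves 1, 2, 3 (on classical crossings), and the virtual Reidemeister moves: the analogues of moves 1, 2, 3 with all crossings virtual, and the mixed move in which a strand having only virtual crossings passes over/past a classical crossing. A virtual tangle is oriented if every component is oriented. The components are ordered $T_1,\ldots,T_n$, and the $i$-th component is assigned a variable $t_i$. **Sign.** The sign $\mathrm{sgn}(c)=\pm1$ of a classical crossing $c$ of oriented strands is $+1$ if (direction of over-strand, direction of under-strand) is a positively oriented basis of the plane, and $-1$ otherwise. **Intersection index.** Let $c$ be a classical self-crossing of a component $T_i$. Smooth $c$ according to orientation; $T_i$ is replaced by two oriented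 components $L_1,L_2$ (ordered arbitrarily). Forget the over/under information at the remaining classical crossings (pass to the flat diagram); virtual crossings remain virtual. To each flat (non-virtual) crossing $x$ between $L_1$ and $L_2$ assign the sign $\mathrm{sgn}(x)$ it would have as a classical crossing with $L_1$ over $L_2$. Then $i(c)=\sum_{x\in L_1\cap L_2}\mathrm{sgn}(x)$, ignoring crossings that involve components of the tangle other than $L_1,L_2$. Exchanging $L_1$ and $L_2$ changes $i(c)$ by a sign, so $|i(c)|$ is well defined. **Virtual linking number.** For distinct components $T_i,T_j$, $vlk(T_i,T_j)=\sum \mathrm{sgn}(d)$, summed over the classical crossings $d$ at which $T_i$ passes over $T_j$. **The polynomials.** For an oriented virtual tangle $T$ with ordered components $T_1,\ldots,T_n$: $$p_{sc}(T)=\sum_{i=1}^n\sum_{c\in T_i}\mathrm{sgn}(c)(t_i^{|i(c)|}-1)$$ (inner sum over classical self-crossings $c$ of $T_i$), $$p_{lk}(T)=p_{sc}(T)+\sum_{i<j}\bigl[a\cdot vlk(T_i,T_j)+b\cdot vlk(T_j,T_i)\bigr]t_it_j,$$ $$p_{lk,L}(T)=p_{sc}(T)+\sum_{i<j}\Bigl(a\cdot vlk(T_i,T_j)\,t_it_j^{-1}+b\cdot vlk(T_j,T_i)\,t_i^{-1}t_j\Bigr).$$ The two invariants $p_{lk}$ and $p_{lk,L}$ are taken with the same $a,b$, which are the same for every pair of components. All three are invariants of oriented virtual tangles with ordered components.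
   Formalization: The claim fails for some a, b: the first assertion is stated for (a,b) ≠ (0,0), since otherwise all three polynomials coincide; the second for a and b both nonzero, since if one is zero p_lk determines p_{lk,L}. *)

(* Defs.v *)
From HB Require Import structures.
From mathcomp Require Import all_boot all_order all_algebra.
From mathcomp Require Import all_classical all_reals all_analysis.
From mathcomp Require monalg.
(* The notations of monalg clash with those of mathcomp-analysis. *)
Import -(notations) monalg.
From Stdlib Require Import Relation_Operators.

Set Implicit Arguments.
Unset Strict Implicit.
Unset Printing Implicit Defensive.
Import Order.TTheory GRing.Theory Num.Theory.
Import numFieldNormedType.Exports.
Local Open Scope classical_set_scope.
Local Open Scope ring_scope.
Local Open Scope quotient_scope.

Section Plane.
Variable R : realType.

Definition plane : Type := (R * R)%type.

Definition det2 (v w : plane) : R := v.1 * w.2 - v.2 * w.1.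

Definition square : set plane := [set z | 0 <= z.1 <= 1 /\ 0 <= z.2 <= 1].
Definition open_square : set plane := [set z | 0 < z.1 < 1 /\ 0 < z.2 < 1].
Definition top_bottom : set plane :=
  [set z | 0 < z.1 < 1 /\ (z.2 = 0 \/ z.2 = 1)].

Definition disc (z : plane) (r : R) : set plane :=
  [set w | (w.1 - z.1) ^+ 2 + (w.2 - z.2) ^+ 2 <= r ^+ 2].

Definition velocity (g : R -> R * R) (s : R) : R * R := 'D_1 g s.

Definition C1_curve (g : R -> R * R) : Prop :=
  (forall s, derivable g s 1) /\ continuous (velocity g).

End Plane.

(** * Virtual tangle diagrams *)

(* A point of the source of the immersion: (component, parameter). *)
Definition source (R : realType) (n : nat) : Type := ('I_n * R)%type.

(* A closed component is a 1-periodic curve with fundamental domain [0, 1[; a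
   long component is the restriction of its curve to [0, 1] (values at other
   parameters are irrelevant; a C^1 curve on [0, 1] always extends).
   Components are oriented by increasing parameter and ordered by their index. *)
Definition param_dom (R : realType) (closed : bool) : set R :=
  [set s | 0 <= s /\ (if closed then s < 1 else s <= 1)].

(* p and q are the two preimages of a double point of the immersion. *)
Definition double_pt (R : realType) (n : nat) (is_closed : 'I_n -> bool)
    (crv : 'I_n -> R -> R * R) (p q : source R n) : Prop :=
  [/\ param_dom (is_closed p.1) p.2, param_dom (is_closed q.1) q.2, p <> q
    & crv p.1 p.2 = crv q.1 q.2].

(* [over (p, q)] says that the double point with preimages p, q is a classical
   crossing at which the strand through p passes over the strand through q.
   A double point p, q with neither [over (p, q)] nor [over (q, p)] is a virtual
   crossing.  Thus the set [over] is in bijection with the classical crossings. *)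
Record diagram (R : realType) (n : nat) := Diagram {
  is_closed : 'I_n -> bool;
  crv : 'I_n -> R -> R * R;
  over : set (source R n * source R n);
  crv_C1 : forall i, C1_curve (crv i);
  crv_periodic : forall i, is_closed i -> forall s, crv i (s + 1) = crv i s;
  crv_immersed : forall i s, param_dom (is_closed i) s ->
    velocity (crv i) s != 0;
  crv_interior : forall i s, param_dom (is_closed i) s ->
    is_closed i \/ 0 < s < 1 -> open_square (crv i s);
  crv_ends : forall i s, ~~ is_closed i -> s = 0 \/ s = 1 ->
    top_bottom (crv i s) /\ (velocity (crv i) s).2 != 0;
  double_interior : forall p q, double_pt is_closed crv p q ->
    open_square (crv p.1 p.2);
  double_finite : finite_set [set c | double_pt is_closed crv c.1 c.2];
  double_transverse : forall p q, double_pt is_closed crv p q ->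
    det2 (velocity (crv p.1) p.2) (velocity (crv q.1) q.2) != 0;
  no_triple : forall p q r,
    double_pt is_closed crv p q -> double_pt is_closed crv p r -> q = r;
  over_double : forall p q, over (p, q) -> double_pt is_closed crv p q;
  over_asym : forall p q, over (p, q) -> ~ over (q, p)
}.

HB.instance Definition _ (R : realType) n := gen_eqMixin (diagram R n).
HB.instance Definition _ (R : realType) n := gen_choiceMixin (diagram R n).

Section Diagrams.
Variables (R : realType) (n : nat).
Implicit Types (D : diagram R n) (p q : source R n).

Definition in_dom D p : Prop := param_dom (is_closed D p.1) p.2.
Definition position D p : R * R := crv D p.1 p.2.
Definition dir D p : R * R := velocity (crv D p.1) p.2.
Definition double_at D p q : Prop := double_pt (is_closed D) (crv D) p q.
Definition classical D p q : Prop := over D (p, q) \/ over D (q, p).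
Definition virtual D p q : Prop := double_at D p q /\ ~ classical D p q.

(* The sign that the double point p, q has (or would have) as a classical
   crossing with the strand through p over the strand through q. *)
Definition csgn D p q : int := sgz (det2 (dir D p) (dir D q)).

(** * Equivalence of diagrams *)

(* C^1 isotopies of the square, relative to its boundary.  The maps [H tau] are
   taken to be C^1 on the whole plane, but only their restriction to the square
   matters. *)
Definition planar_isotopy (H : R -> R * R -> R * R) : Prop :=
  [/\ [/\ continuous (fun x : R * (R * R) => H x.1 x.2),
          forall tau z, differentiable (H tau) z
        & forall v : R * R,
            continuous (fun x : R * (R * R) => 'D_v (H x.1) x.2 : R * R)],
      forall z, square z -> H 0 z = z
    & forall tau, 0 <= tau <= 1 ->
      [/\ set_bij (square (R:=R)) (square (R:=R)) (H tau),
          forall z, square z -> ~ open_square z -> H tau z = z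
        & forall z, square z ->
            det2 ('D_((1, 0) : R * R) (H tau) z)
                 ('D_((0, 1) : R * R) (H tau) z) != 0]].

(* Orientation preserving reparametrizations of the interval [0, 1] or of the
   circle R/Z. *)
Definition reparam (cl : bool) (phi : R -> R) : Prop :=
  [/\ forall s, derivable phi s 1, continuous (phi^`())%classic,
      forall s, 0 < (phi^`())%classic s
    & if cl then forall s, phi (s + 1) = phi s + 1
      else phi 0 = 0 /\ phi 1 = 1].

(* Brings a parameter of a closed component back to [0, 1[. *)
Definition wrap (cl : bool) (s : R) : R :=
  if cl then s - (Num.floor s)%:~R else s.

Definition isotopic D D' : Prop :=
  exists (H : R -> R * R -> R * R) (phi : 'I_n -> R -> R),
    let rho p : source R n := (p.1, wrap (is_closed D p.1) (phi p.1 p.2)) in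
    [/\ planar_isotopy H,
        forall i, reparam (is_closed D i) (phi i),
        is_closed D' =1 is_closed D,
        forall p, in_dom D' p -> position D' p = H 1 (position D (rho p))
      & forall p q, in_dom D' p -> in_dom D' q ->
          (over D' (p, q) <-> over D (rho p, rho q))].

(* [(i, (u, v))] is the arc of component i with parameters in [u, v]. *)
Definition in_arc k (A : 'I_k -> 'I_n * (R * R)) (m : 'I_k) p : Prop :=
  p.1 = (A m).1 /\ (A m).2.1 <= p.2 <= (A m).2.2.
Definition in_arcs k (A : 'I_k -> 'I_n * (R * R)) p : Prop :=
  exists m, in_arc A m p.

(* D and D' agree outside a disc, which both meet exactly in the arcs A.  Up to
   isotopy there is no loss of generality in taking a round disc, and in taking
   the arcs away from the base points of the closed components. *)
Definition same_outside k (A : 'I_k -> 'I_n * (R * R)) D D' : Prop :=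
  [/\ is_closed D' =1 is_closed D,
      forall m, 0 < (A m).2.1 /\ (A m).2.1 < (A m).2.2 /\ (A m).2.2 < 1,
      forall m m' p, in_arc A m p -> in_arc A m' p -> m = m',
      exists (z : R * R) (r : R),
        [/\ 0 < r, disc z r `<=` open_square (R:=R),
            forall p, in_arcs A p ->
              disc z r (position D p) /\ disc z r (position D' p)
          & forall p, in_dom D p -> ~ in_arcs A p ->
              position D' p = position D p /\ ~ disc z r (position D p)]
    & forall p q, ~ in_arcs A p -> ~ in_arcs A q ->
        (over D' (p, q) <-> over D (p, q))].

(* In each move below the arcs lie in a disc, so the listed double points
   determine the picture up to isotopy of the disc; conversely the conditions on
   signs and on the order of the double points along the arcs hold in the usual
   picture of the move, for all choices of orientations. *)

(* First move, classical or virtual: D' has a simple arc where D has a kink. *)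
Definition move1 D D' : Prop :=
  exists A : 'I_1 -> 'I_n * (R * R),
  [/\ same_outside A D D',
      forall p q, in_arcs A p -> ~ double_at D' p q
    & exists p q, [/\ in_arcs A p, in_arcs A q, double_at D p q
      & forall p' q', in_arcs A p' -> double_at D p' q' ->
          (p', q') = (p, q) \/ (p', q') = (q, p)]].

(* Second move, classical (the first arc being over the second) or virtual: D'
   has two disjoint simple arcs, D has a bigon. *)
Definition move2 D D' : Prop :=
  exists A : 'I_2 -> 'I_n * (R * R),
  [/\ same_outside A D D',
      forall p q, in_arcs A p -> ~ double_at D' p q
    & exists p1 q1 p2 q2,
      [/\ [/\ in_arc A ord0 p1, in_arc A ord0 p2,
              in_arc A ord_max q1 & in_arc A ord_max q2],
          p1 <> p2 /\ double_at D p1 q1 /\ double_at D p2 q2,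
          forall p q, in_arcs A p -> double_at D p q ->
            (p, q) \in [:: (p1, q1); (q1, p1); (p2, q2); (q2, p2)],
          csgn D p1 q1 = - csgn D p2 q2
        & (over D (p1, q1) /\ over D (p2, q2)) \/
          (virtual D p1 q1 /\ virtual D p2 q2)]].

(* Inside the disc the three arcs form a triangle: they are simple, and any two
   of them, k and l, meet exactly once, at the double point X k l, X l k.
   If the arcs are straightened to segments with directions w_0, w_1, w_2, then
   the displacements a w_0, b w_1, c w_2 along the sides of the triangle satisfy
   b w_1 = a w_0 + c w_2, whence (a : b : c) = (f_12 : f_02 : f_01) for
   f_kl = det (w_k, w_l); the sign eps of the ratio is reversed when one of the
   arcs is moved across the crossing of the two others. *)
Definition triangle D (A : 'I_3 -> 'I_n * (R * R))
    (X : 'I_3 -> 'I_3 -> source R n) (eps : int) : Prop :=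
  let f k l := csgn D (X k l) (X l k) in
  let o0 := inord 0 : 'I_3 in let o1 := inord 1 : 'I_3 in
  let o2 := inord 2 : 'I_3 in
  [/\ forall k l, k <> l -> in_arc A k (X k l) /\ double_at D (X k l) (X l k),
      forall p q, in_arcs A p -> double_at D p q ->
        exists k l, k <> l /\ (p, q) = (X k l, X l k)
    & [/\ sgz ((X o0 o2).2 - (X o0 o1).2) = eps * f o1 o2,
          sgz ((X o1 o2).2 - (X o1 o0).2) = eps * f o0 o2
        & sgz ((X o2 o1).2 - (X o2 o0).2) = eps * f o0 o1]].

(* Third move: the triangle is reversed, corresponding double points have the
   same signs and are of the same kind.  Either all crossings are classical and
   arc 0 is over arc 1, which is over arc 2, and arc 0 is over arc 2; or arc 0
   has only virtual crossings, and the crossing of the two other arcs is virtual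
   (third virtual move) or classical (mixed move). *)
Definition move3 D D' : Prop :=
  exists A : 'I_3 -> 'I_n * (R * R), exists X X' eps,
  [/\ same_outside A D D',
      eps = 1 \/ eps = -1,
      triangle D A X eps /\ triangle D' A X' (- eps),
      forall k l, k <> l -> csgn D' (X' k l) (X' l k) = csgn D (X k l) (X l k)
    & (forall k l : 'I_3, (k < l)%N ->
         over D (X k l, X l k) /\ over D' (X' k l, X' l k)) \/
      ((forall l : 'I_3, l <> ord0 ->
         virtual D (X ord0 l) (X l ord0) /\
         virtual D' (X' ord0 l) (X' l ord0)) /\
       (forall k l : 'I_3, k <> l ->
         (over D' (X' k l, X' l k) <-> over D (X k l, X l k))))].

Definition one_move D D' : Prop :=
  [\/ isotopic D D', move1 D D', move2 D D' | move3 D D'].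

Definition equivalent D D' : bool := `[< clos_refl_sym_trans _ one_move D D' >].

Lemma equivalent_refl : reflexive equivalent.
Proof. by move=> D; apply/asboolP; exact: rst_refl. Qed.

Lemma equivalent_sym : symmetric equivalent.
Proof.
by move=> D D'; apply/idP/idP => /asboolP h; apply/asboolP; exact: rst_sym.
Qed.

Lemma equivalent_trans : transitive equivalent.
Proof.
move=> D' D D'' /asboolP h /asboolP h'; apply/asboolP.
exact: rst_trans h h'.
Qed.

Canonical equivalent_equiv :=
  EquivRel equivalent equivalent_refl equivalent_sym equivalent_trans.

End Diagrams.

Definition vtangle_of (R : realType) (n : nat) : Type :=
  {eq_quot (@equivalent_equiv R n)}.

(* Oriented virtual tangles with finitely many ordered components. *)
Definition vtangle (R : realType) : Type := {n : nat & vtangle_of R n}.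

(** * The polynomials *)

(* Monomials t^m in the variables t_i (i : nat), with m a finitely supported
   integer exponent vector, and the Q-module with basis the monomials: the
   additive group of Q[t_i, t_i^-1 | i : nat], in which the polynomials of all
   tangles can be compared. *)
Definition exponents := malg nat int.
Definition laurent := malg exponents rat.

Definition monomial (m : exponents) : laurent := mkmalgU m 1.
Definition expo (i : nat) (k : int) : exponents := mkmalgU i k.

Section Polynomials.
Variables (R : realType) (n : nat).
Implicit Types (D : diagram R n) (c : source R n * source R n).

(* The two components L1 and L2 created by the oriented smoothing of T_i at a
   self-crossing c: the parameters strictly between the two preimages of c,
   and the remaining ones (the two preimages belong to neither). *)
Definition smooth1 D c : set (source R n) :=
  [set p | [/\ in_dom D p, p.1 = c.1.1
    & Num.min c.1.2 c.2.2 < p.2 < Num.max c.1.2 c.2.2]].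
Definition smooth2 D c : set (source R n) :=
  [set p | [/\ in_dom D p, p.1 = c.1.1
    & p.2 < Num.min c.1.2 c.2.2 \/ Num.max c.1.2 c.2.2 < p.2]].

Definition crossing_index D c : int :=
  \sum_(x \in [set x | [/\ smooth1 D c x.1, smooth2 D c x.2
                         & classical D x.1 x.2]]) csgn D x.1 x.2.

Definition self_crossings D (i : 'I_n) : set (source R n * source R n) :=
  [set c | [/\ over D c, c.1.1 = i & c.2.1 = i]].

Definition vlk D (i j : 'I_n) : int :=
  \sum_(d \in [set d | [/\ over D d, d.1.1 = i & d.2.1 = j]]) csgn D d.1 d.2.

Definition diag_psc D : laurent :=
  \sum_(i < n) \sum_(c \in self_crossings D i)
    (monomial (expo i `|crossing_index D c|) - monomial 0) *~ csgn D c.1 c.2.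

Definition diag_plk (a b : rat) D : laurent :=
  diag_psc D + \sum_(i < n) \sum_(j < n | (i < j)%N)
    (a * (vlk D i j)%:~R + b * (vlk D j i)%:~R) *:
      monomial (expo i 1 + expo j 1).

Definition diag_plkL (a b : rat) D : laurent :=
  diag_psc D + \sum_(i < n) \sum_(j < n | (i < j)%N)
    ((a * (vlk D i j)%:~R) *: monomial (expo i 1 + expo j (-1)) +
     (b * (vlk D j i)%:~R) *: monomial (expo i (-1) + expo j 1)).

End Polynomials.

(* As these expressions are invariant under equivalence, they may be evaluated
   at any representative. *)
Definition psc (R : realType) (T : vtangle R) : laurent :=
  diag_psc (repr (projT2 T)).
Definition plk (R : realType) (a b : rat) (T : vtangle R) : laurent :=
  diag_plk a b (repr (projT2 T)).
Definition plkL (R : realType) (a b : rat) (T : vtangle R) : laurent :=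
  diag_plkL a b (repr (projT2 T)).

Definition stronger (T U V : Type) (A : T -> U) (B : T -> V) : Prop :=
  (forall K K', A K = A K' -> B K = B K') /\
  (exists T1 T2, B T1 = B T2 /\ A T1 <> A T2).

(* Main.v *)
Require Import Defs.
From HB Require Import structures.
From mathcomp Require Import all_boot all_order all_algebra.
From mathcomp Require Import finmap.
From mathcomp Require Import all_classical all_reals all_analysis.
From mathcomp Require Import zify ring lra.
From mathcomp Require monalg.
Import -(notations) monalg.
Import Defs.

Set Implicit Arguments.
Unset Strict Implicit.
Unset Printing Implicit Defensive.
Import Order.TTheory GRing.Theory Num.Theory.
Import numFieldNormedType.Exports.
Local Open Scope classical_set_scope.
Local Open Scope ring_scope.

(** The three polynomials have the same self-crossing part and differ in what
    they record about pairs of components.  Each comparison has an algebraic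
    half, that one polynomial determines another, and a topological half, that
    the converse fails.

    The weaker polynomial can be read off the stronger one.  The self-crossing
    part only involves monomials in one variable, whereas a linking monomial
    involves two, so erasing the monomials with two variables turns [plk] into
    [psc] ([psc_of_plk]).  Replacing every exponent by its absolute value turns
    both t_i / t_j and t_j / t_i into t_i t_j and changes no self-crossing term,
    so it turns [plkL] into [plk] ([plk_of_plkL]).

    For the strictness, two strands that wave across each other, with suitable
    choices of over, under and virtual crossings, have no self-crossings and
    realize every pair (p, q) of virtual linking numbers ([realize_linking]).
    Then [psc] vanishes, [plk] is (a p + b q) t_1 t_2, and [plkL] is
    a p t_1 / t_2 + b q t_2 / t_1.  Comparing (1, 0) or (0, 1) with (0, 0)
    separates [plk] from [psc]; a nonzero integral solution of a p + b q = 0,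
    compared with (0, 0), separates [plkL] from [plk].

    The polynomials of a tangle are those of a representative that is only
    known up to equivalence, so all this rests on invariance.  Invariance is
    proved on tangles without closed components, a class preserved by the moves
    and containing the wave tangles.  There each crossing has a signed index,
    and [psc] and the virtual linking numbers are instances of one expression
    [gauss_sum F], the sum over the crossings of a weight F that depends on the
    two components, the index and the sign, vanishes on self-crossings of index
    zero, and is odd in the sign ([diag_pscE], [vlkE]).

    A crossing is a chord of the Gauss diagram joining its two parameters, and
    its index counts, with signs, the chords that separate its ends
    ([crossing_indexE]).  An isotopy reparametrizes the strands increasingly and
    preserves the signs, as its Jacobian stays positive ([isotopic_invariant]).
    A move changes the Gauss diagram within a few disjoint intervals of
    parameters only; a chord with no end there sees every chord with both ends
    there through the intervals alone, and conversely.  Hence only the mutual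
    position of the few chords of the move matters ([gauss_sum_local]): the
    chord of a kink has index zero; the two chords of a bigon have equal indices
    and opposite signs; and in a triangle the change in the order of the
    crossings along the three arcs is exactly compensated ([third_arc]). *)

(** * Monomials *)

(** The m-th coefficient of the image of a Laurent polynomial under the
    linear map sending each monomial of exponent k to h k. *)
Definition lincoef (h : exponents -> laurent) (m : exponents) : laurent -> rat :=
  mmap idfun (fun k => mcoeff m (h k)).
HB.instance Definition _ h m := GRing.Additive.on (lincoef h m).

Lemma lincoef_monomial h m k : lincoef h m (monomial k) = mcoeff m (h k).
Proof. by rewrite /lincoef mmapU mul1r. Qed.

Lemma lincoefZ h m (a : rat) x : lincoef h m (a *: x) = a * lincoef h m x.
Proof.
rewrite /lincoef (mmapEw (msuppZ_le _ _)) mmapE big_distrr /=.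
by apply/eq_bigr => k _; rewrite mcoeffZ mulrA.
Qed.

Definition abs_exponents (m : exponents) : exponents :=
  \sum_(i <- msupp m) expo i `|mcoeff i m|.

Lemma mcoeff_expo i k j : mcoeff j (expo i k) = if i == j then k else 0.
Proof. by rewrite /expo mcoeffU; case: eqP => _; rewrite ?mulr1n ?mulr0n. Qed.

Lemma mcoeff_abs_exponents m j : mcoeff j (abs_exponents m) = `|mcoeff j m|.
Proof.
rewrite /abs_exponents raddf_sum /=.
case: (boolP (j \in msupp m)) => [jm|jm]; last rewrite (mcoeff_outdom jm).
  rewrite (big_fsetD1 j)//= mcoeff_expo eqxx big1_seq ?addr0// => i /andP[_].
  by rewrite in_fsetD1 mcoeff_expo => /andP[/negPf->].
rewrite normr0 big1_seq// => i /andP[_ im]; rewrite mcoeff_expo.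
by case: eqP => // ij; rewrite -ij im in jm.
Qed.

Definition drop_mixed (m : exponents) : laurent :=
  if (#|` msupp m| <= 1)%N then monomial m else 0.

Lemma drop_mixed_expo i (k : int) : drop_mixed (expo i k) = monomial (expo i k).
Proof.
by rewrite /drop_mixed ifT// /expo msuppU; case: ifP; rewrite ?cardfs0 ?cardfs1.
Qed.

Lemma drop_mixed0 : drop_mixed 0 = monomial 0.
Proof. by rewrite /drop_mixed msupp0 cardfs0. Qed.

Lemma drop_mixed_linking i j : i != j -> drop_mixed (expo i 1 + expo j 1) = 0.
Proof.
move=> ij; rewrite /drop_mixed ifF//; apply/negbTE; rewrite -ltnNge.
have : fsubset [fset i; j]%fset (msupp (expo i 1 + expo j 1)).
  apply/fsubsetP => k; rewrite !inE -mcoeff_neq0 mcoeffD !mcoeff_expo.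
  by case/orP=> /eqP ->; rewrite ?eqxx ?(negPf ij) ?(eq_sym j) ?(negPf ij).
by move/fsubset_leq_card; rewrite cardfs2 ij.
Qed.

Section Polynomials.
Variables (R : realType) (n : nat) (D : diagram R n).

(** Self-crossings only contribute monomials t_i^k with k >= 0. *)
Lemma lincoef_psc h m :
    (forall i (k : nat), h (expo i k) = monomial (expo i k)) ->
    h 0 = monomial 0 ->
  lincoef h m (diag_psc D) = mcoeff m (diag_psc D).
Proof.
move=> hE h0; apply: etrans (raddf_sum (lincoef h m) _ _ _) _; apply/esym.
apply: etrans (raddf_sum (mcoeff m) _ _ _) _; apply/esym.
apply: eq_bigr => i _; apply: etrans (raddf_sum (lincoef h m) _ _ _) _; apply/esym.
apply: etrans (raddf_sum (mcoeff m) _ _ _) _; apply/esym.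
apply: eq_bigr => c _; move: (crossing_index D c) (csgn D c.1 c.2) => k e.
have E (i' a : nat) : lincoef h m (monomial (expo i' a) - monomial 0) =
    mcoeff m (monomial (expo i' a) - monomial 0).
  apply: etrans (raddfB (lincoef h m) _ _) _.
  apply: etrans _ (esym (raddfB (mcoeff m) _ _)).
  exact: (congr2 (fun x y : rat => x - y)
    (etrans (lincoef_monomial h m _) (congr1 (mcoeff m) (hE i' a)))
    (etrans (lincoef_monomial h m _) (congr1 (mcoeff m) h0))).
rewrite -abszE.
apply: etrans (raddfMz (lincoef h m) e _) _.
apply: etrans _ (esym (raddfMz (mcoeff m) e _)).
exact: (congr1 (fun x : rat => x *~ e) (E i _)).
Qed.

Lemma psc_of_plk a b m :
  mcoeff m (diag_psc D) = lincoef drop_mixed m (diag_plk a b D).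
Proof.
apply: etrans _ (esym (raddfD (lincoef drop_mixed m) _ _)).
rewrite -[LHS]addr0; apply: (congr2 (fun x y : rat => x + y)); apply: esym.
  by apply: lincoef_psc; [move=> i k; exact: drop_mixed_expo | exact: drop_mixed0].
apply: etrans (raddf_sum (lincoef drop_mixed m) _ _ _) _; apply: big1 => i _.
apply: etrans (raddf_sum (lincoef drop_mixed m) _ _ _) _; apply: big1 => j ij.
apply: etrans (lincoefZ _ _ _ _) _; rewrite lincoef_monomial.
by rewrite drop_mixed_linking ?mcoeff0 ?mulr0 ?ltn_eqF.
Qed.

Lemma abs_exponents_expo i k : abs_exponents (expo i k) = expo i `|k|.
Proof.
apply/malgP => j; rewrite mcoeff_abs_exponents !mcoeff_expo.
by case: eqP; rewrite ?normr0.
Qed.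

Lemma abs_exponents_linking i j (k l : int) : i != j ->
  abs_exponents (expo i k + expo j l) = expo i `|k| + expo j `|l|.
Proof.
move=> ij; apply/malgP => u; rewrite mcoeff_abs_exponents !mcoeffD !mcoeff_expo.
by case: eqP => [<-|_]; rewrite ?(eq_sym j) ?(negPf ij) ?add0r ?addr0//;
  case: eqP; rewrite ?normr0.
Qed.

Lemma plk_of_plkL a b m : mcoeff m (diag_plk a b D) =
  lincoef (monomial \o abs_exponents) m (diag_plkL a b D).
Proof.
set L := lincoef (monomial \o abs_exponents) m.
apply: etrans (raddfD (mcoeff m) _ _) _; apply: etrans _ (esym (raddfD L _ _)).
apply: (congr2 (fun x y : rat => x + y)).
  apply: esym; apply: lincoef_psc => [i k|] /=; first by rewrite abs_exponents_expo.
  by congr monomial; apply/malgP => j; rewrite mcoeff_abs_exponents mcoeff0 normr0.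
apply: etrans (raddf_sum (mcoeff m) _ _ _) _; apply: esym.
apply: etrans (raddf_sum L _ _ _) _; apply: esym; apply: eq_bigr => i _.
apply: etrans (raddf_sum (mcoeff m) _ _ _) _; apply: esym.
apply: etrans (raddf_sum L _ _ _) _; apply: esym; apply: eq_bigr => j ij.
have nij : (i : nat) != j by rewrite ltn_eqF.
apply: etrans (mcoeffZ _ _ _) _; rewrite mulrDl; apply: etrans _ (esym (raddfD L _ _)).
apply: (congr2 (fun x y : rat => x + y)); apply: esym;
  apply: etrans (lincoefZ _ _ _ _) _; rewrite lincoef_monomial /=;
  by rewrite abs_exponents_linking.
Qed.

End Polynomials.

(** * Weighted sums over the crossings *)

Section FiniteSums.
Variables (R : realType) (n : nat) (V : zmodType).
Let I := (source R n * source R n)%type.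
Implicit Types (A B : set I) (F : I -> V).

Lemma fsumIr A B F :
  \sum_(x \in A `&` B) F x = \sum_(x \in A) (if x \in B then F x else 0).
Proof. exact: fsbig_mkcondr. Qed.

Lemma fsumD A F G : finite_set A ->
  \sum_(x \in A) (F x + G x) = \sum_(x \in A) F x + \sum_(x \in A) G x.
Proof. exact: fsbig_split. Qed.

Lemma fsumID B A F : finite_set A ->
  \sum_(x \in A) F x = \sum_(x \in A `&` B) F x + \sum_(x \in A `&` ~` B) F x.
Proof. exact: fsbigID. Qed.

Lemma fsumU A B F : finite_set A -> finite_set B -> A `&` B `<=` set0 ->
  \sum_(x \in A `|` B) F x = \sum_(x \in A) F x + \sum_(x \in B) F x.
Proof. exact: fsbigU0. Qed.

Lemma eq_fsum A F G : (forall x, A x -> F x = G x) ->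
  \sum_(x \in A) F x = \sum_(x \in A) G x.
Proof. by move=> FG; apply: eq_fsbigr => x; rewrite inE => /FG. Qed.

Lemma fsum_image (P : set I) (h : I -> I) F : set_inj P h ->
  \sum_(x \in h @` P) F x = \sum_(j \in P) F (h j).
Proof. exact: fsbig_image. Qed.

End FiniteSums.

Section GaussSums.
Variables (R : realType) (n : nat).
Implicit Types (D : diagram R n) (p q : source R n).
Implicit Types (c d : source R n * source R n).

(** The open interval spanned by the two ends of c, as a boolean condition on
    parameters that does not order these ends. *)
Definition between c p : bool :=
  (c.1.2 < p.2 < c.2.2) || (c.2.2 < p.2 < c.1.2).

(** The signed linking of two chords of one component: it vanishes unless
    exactly one end of d lies between the ends of c. *)
Definition pairing D c d : int :=
  if [&& c.2.1 == c.1.1, d.1.1 == c.1.1 & d.2.1 == c.1.1]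
  then csgn D d.1 d.2 * ((between c d.1 : nat)%:Z - (between c d.2 : nat)%:Z)
  else 0.

Definition gauss_index D c : int := \sum_(d \in over D) pairing D c d.

Definition gauss_sum (V : zmodType) (F : 'I_n -> 'I_n -> int -> int -> V) D : V :=
  \sum_(c \in over D) F c.1.1 c.2.1 (gauss_index D c) (csgn D c.1 c.2).

Lemma betweenE c p :
  (Num.min c.1.2 c.2.2 < p.2 < Num.max c.1.2 c.2.2) = between c p.
Proof. by rewrite /between; case: (ltrP c.1.2 c.2.2) => ?; lra. Qed.

Lemma not_betweenE c p : p.2 != c.1.2 -> p.2 != c.2.2 ->
  (p.2 < Num.min c.1.2 c.2.2) || (Num.max c.1.2 c.2.2 < p.2) = ~~ between c p.
Proof.
rewrite -betweenE => h1 h2; rewrite negb_and -!leNgt !le_eqVlt.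
case: (ltrP c.1.2 c.2.2) => h; first by rewrite (negPf h1) eq_sym (negPf h2).
by rewrite (negPf h2) eq_sym (negPf h1).
Qed.

Lemma double_sym D p q : double_at D p q -> double_at D q p.
Proof. by case=> hp hq pq e; split=> // /esym. Qed.

Lemma over_finite D : finite_set (over D).
Proof.
apply: sub_finite_set (double_finite D) => -[p q]; exact: over_double.
Qed.

Lemma over_eql D p q q' : over D (p, q) -> over D (p, q') -> q = q'.
Proof. by move=> /over_double h /over_double; exact: no_triple h. Qed.

Lemma over_eqr D p p' q : over D (p, q) -> over D (p', q) -> p = p'.
Proof.
by move=> /over_double/double_sym h /over_double/double_sym; exact: no_triple h.
Qed.

(** A parameter has at most one partner, so it cannot be on top in one crossing
    and at the bottom of another. *)
Lemma over_chain D p q r : over D (p, q) -> ~ over D (q, r).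
Proof.
move=> pq qr; have pr : p = r.
  exact: no_triple (double_sym (over_double pq)) (over_double qr).
by apply: over_asym pq _; rewrite pr.
Qed.

Lemma csgnC D p q : csgn D p q = - csgn D q p.
Proof.
by rewrite /csgn -sgzN /det2 opprB; congr (sgz (_ - _)); exact: mulrC.
Qed.

Lemma swap_inj (T : Type) : injective (fun x : T * T => (x.2, x.1)).
Proof. by move=> [a b] [a' b'] [-> ->]. Qed.

Definition swap (x : source R n * source R n) := (x.2, x.1).

(** The classical double points, as ordered pairs of parameters, are the pairs
    in [over] and their transposes. *)
Lemma fsum_classical D (S : set (source R n * source R n))
    (F : source R n * source R n -> int) :
  \sum_(x \in [set x | S x /\ classical D x.1 x.2]) F x =
  \sum_(d \in over D) ((if d \in S then F d else 0) +
                      (if swap d \in S then F (swap d) else 0)).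
Proof.
have -> : [set x | S x /\ classical D x.1 x.2] =
    (over D `&` S) `|` (swap @` (over D `&` (S \o swap))).
  apply/seteqP; split=> [[p q] /= [h [ov|ov]]|[p q]]; first by left.
    by right; exists (q, p).
  case=> [[ov h]|[[q' p'] /= [ov h] [<- <-]]]; split=> //; first by left.
  by right.
have fin P : finite_set (over D `&` P).
  by apply: sub_finite_set (over_finite D); apply: subIsetl.
rewrite fsumU //; last 2 first.
- exact: finite_image.
- by move=> [p q] [[ov _] [[p' q'] [ov' _] [pe qe]]]; apply: (over_asym ov);
    rewrite -pe -qe.
rewrite fsum_image; last by move=> x y _ _; exact: swap_inj.
rewrite !fsumIr -fsumD; last exact: over_finite.
apply: eq_fsum => d _.
have -> : (d \in (S \o swap : set _)) = (swap d \in S).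
  by apply/idP/idP => /set_mem h; apply/mem_set.
by [].
Qed.

(** A crossing d with ends p and q counts with opposite signs according to
    which end is on the first loop, since exchanging the strands reverses the
    sign; it does not count if both ends are on the same loop.  The loops omit
    the ends of c itself, where only d = c could sit. *)
Lemma crossing_indexE D c : over D c -> c.1.1 = c.2.1 ->
  crossing_index D c = gauss_index D c.
Proof.
case: c => u v /= uv eqc; rewrite /crossing_index.
pose S : set (source R n * source R n) :=
  [set x | smooth1 D (u, v) x.1 /\ smooth2 D (u, v) x.2].
rewrite (_ : mkset _ = [set x | S x /\ classical D x.1 x.2]); last first.
  by apply/seteqP; split=> x [] // []; split.
rewrite fsum_classical; apply: eq_fsum => -[p q] ov; rewrite /swap /=.
have [dp dq _ _] := over_double ov.
have mS x : (x \in S) = `[< in_dom D x.1 /\ in_dom D x.2 >] &&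
    [&& x.1.1 == u.1, x.2.1 == u.1, between (u, v) x.1 &
      (x.2.2 < Num.min u.2 v.2) || (Num.max u.2 v.2 < x.2.2)].
  apply/idP/idP; rewrite inE /S /smooth1 /smooth2/=.
    case=> [[a1 /eqP a2 a3] [b1 /eqP b2 b3]]; apply/andP; split; first exact/asboolP.
    by rewrite a2 b2 -betweenE/= a3/=; apply/orP.
  move=> /andP[/asboolP[h1 h2] /and4P[/eqP a1 /eqP a2 a3 /orP a4]].
  by rewrite -betweenE in a3; split; split.
have asT (x y : source R n) : in_dom D x -> in_dom D y ->
    `[< in_dom D x /\ in_dom D y >] = true by move=> *; apply/asboolP.
rewrite 2!mS /= !asT //= {mS asT}.
rewrite /pairing/= -eqc eqxx/=.
case: (eqVneq p.1 u.1) => pu /=; last by rewrite andbF addr0.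
case: (eqVneq q.1 u.1) => qu /=; last by rewrite addr0.
(* If d shares an end with c, then d = c and neither loop contains its ends. *)
have [epu|npu] := eqVneq p u.
  have -> : q = v by apply: over_eql uv; rewrite -epu.
  by rewrite epu /between/= !(ltxx, andbF, andbT, orbF) /= ?addr0 ?mulr0.
have vq : q <> v.
  by move=> e; move: npu; rewrite (over_eqr uv (_ : over D (p, v))) ?eqxx -?e.
have ne (x y : source R n) : x.1 = y.1 -> x <> y -> x.2 != y.2.
  by case: x y => [x1 x2] [y1 y2] /= -> h; apply/eqP => e; apply: h; rewrite e.
have h1 : p.2 != u.2 by apply: ne; [rewrite pu | apply/eqP].
have h2 : p.2 != v.2.
  by apply: ne; [rewrite pu | move=> e; apply: (over_chain uv (r := q)); rewrite -e].
have h3 : q.2 != v.2 by apply: ne; [rewrite qu | ].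
have h4 : q.2 != u.2.
  by apply: ne; [rewrite qu | move=> e; apply: (over_chain ov (r := v)); rewrite e].
rewrite (not_betweenE (c := (u, v)) h4 h3) (not_betweenE (c := (u, v)) h1 h2).
rewrite (csgnC D q p).
by case: (between _ p); case: (between _ q) => /=;
  rewrite ?subrr ?mulr0 ?addr0 ?subr0 ?mulr1 ?sub0r ?mulrN1 ?add0r.
Qed.

Lemma fsum_components (V : zmodType) D i j (F : source R n * source R n -> V) :
  \sum_(c \in [set c | [/\ over D c, c.1.1 = i & c.2.1 = j]]) F c =
  \sum_(c \in over D) (if (c.1.1 == i) && (c.2.1 == j) then F c else 0).
Proof.
rewrite (_ : mkset _ = over D `&` [set d | d.1.1 = i /\ d.2.1 = j]); last first.
  by apply/seteqP; split=> d [] => [? ? ?|? [? ?]]; split.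
rewrite fsumIr; apply: eq_fsum => d _; congr (if _ then _ else _).
by apply/idP/andP; rewrite inE /= => -[/eqP ? /eqP ?].
Qed.

Lemma vlkE D i j : vlk D i j =
  gauss_sum (fun i' j' _ e => if (i' == i) && (j' == j) then e else 0) D.
Proof. exact: fsum_components. Qed.

Lemma diag_pscE D : diag_psc D =
  gauss_sum (fun i j k e => if i == j
    then (monomial (expo i `|k|) - monomial 0) *~ e else 0) D.
Proof.
rewrite /diag_psc /gauss_sum fsbig_finite /=; last exact: over_finite.
under eq_bigr => i _.
  rewrite fsum_components fsbig_finite; last exact: over_finite.
  over.
rewrite exchange_big /=.
apply: eq_big_seq => c; rewrite in_fset_set ?inE; last exact: over_finite.
move=> oc; rewrite (bigD1 c.1.1) //= big1 ?addr0 => [|i /negPf ne]; last first.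
  by rewrite eq_sym ne.
rewrite eqxx eq_sym; case: eqP => [e|_]; last exact: erefl.
rewrite crossing_indexE; [exact: erefl | exact: oc | exact: e].
Qed.

End GaussSums.

(** * Isotopies *)

Section Isotopy.
Variables (R : realType) (n : nat).
Implicit Types (D : diagram R n) (p q : source R n).

Definition long D : Prop := forall i, ~~ is_closed D i.

(** The endpoints of a long strand lie on the boundary of the square, where double
    points are excluded. *)
Lemma double_interior_param D p q : long D -> double_at D p q -> 0 < p.2 < 1.
Proof.
move=> lD dpq; have op := double_interior dpq; case: dpq => -[p0].
have /negPf ncl := lD p.1; rewrite ncl => p1 _ _ _.
rewrite !lt_neqAle p0 p1 !andbT; apply/andP; split; apply/eqP => e;
  move: op; rewrite /open_square /=; have [] := @crv_ends _ _ D p.1 p.2 (lD _) _.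
- by left.
- by case=> _ [->|->] _ [_]; rewrite ?ltxx ?andbF.
- by right.
- by case=> _ [->|->] _ [_]; rewrite ?ltxx ?andbF.
Qed.

Lemma open_squareW z : open_square z -> square (R := R) z.
Proof. by case=> /andP[? ?] /andP[? ?]; split; rewrite !ltW. Qed.

Lemma open_square_nbhs z : open_square z -> \forall w \near z, open_square (R := R) w.
Proof.
case: z => x y [/= hx hy].
exists ([set t | 0 < t < 1], [set t | 0 < t < 1]) => [|[a b] [] //].
by split; [have := near_in_itvoo (a := 0) (b := 1) (x := x) |
  have := near_in_itvoo (a := 0) (b := 1) (x := y)]; rewrite in_itv/=;
  move=> /(_ ltac:(assumption)); apply: filterS => t; rewrite in_itv.
Qed.

(** The Jacobian determinant is 1 at time 0 and never vanishes, so by continuity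
    it is still positive at time 1. *)
Lemma isotopy_det_gt0 (H : R -> R * R -> R * R) z :
  planar_isotopy H -> open_square z ->
  0 < det2 ('D_((1, 0) : R * R) (H 1) z) ('D_((0, 1) : R * R) (H 1) z).
Proof.
case=> -[_ dH cH] H0 Ht oz.
have sz := open_squareW oz.
pose f t := det2 ('D_((1, 0) : R * R) (H t) z) ('D_((0, 1) : R * R) (H t) z).
have cD (v : R * R) : continuous (fun t => 'D_v (H t) z : R * R).
  move=> t; apply: (@continuous_comp _ _ _ (fun t : R => (t, z))
      (fun x : R * (R * R) => 'D_v (H x.1) x.2 : R * R)).
  exact: (cvg_pair (F := nbhs t) (@cvg_id _ (nbhs t)) (cvg_cst z)).
  exact: cH.
have c1 v : continuous (fun t => ('D_v (H t) z : R * R).1).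
  move=> t; apply: (@continuous_comp _ _ _ (fun t => 'D_v (H t) z : R * R) fst).
    exact: cD.
  exact: cvg_fst.
have c2 v : continuous (fun t => ('D_v (H t) z : R * R).2).
  move=> t; apply: (@continuous_comp _ _ _ (fun t => 'D_v (H t) z : R * R) snd).
    exact: cD.
  exact: cvg_snd.
have cf : continuous f.
  move=> t.
  exact: (cvgB (cvgM (c1 _ t) (c2 _ t)) (cvgM (c2 _ t) (c1 _ t))).
have f0 : f 0 = 1.
  have e v : 'D_v (H 0) z = v :> R * R.
    rewrite (near_eq_derive (g := id)) ?derive_id//.
    apply: filterS (open_square_nbhs oz) => w /open_squareW; exact: H0.
  by rewrite /f !e /det2 /=; ring.
have fN0 t : 0 <= t <= 1 -> f t != 0 by move=> /Ht[_ _ h]; exact: h.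
rewrite -/(f 1) ltNge; apply/negP => f1.
have [||c c01 fc] := @IVT R f 0 1 0 ler01.
- exact/continuous_subspaceT.
- by rewrite f0 (min_idPr (le_trans f1 ler01)) f1 le_max ler01.
by have := fN0 c; rewrite fc eqxx; move: c01; rewrite in_itv/= => -> /(_ isT).
Qed.

Lemma det2_derive (h : R * R -> R * R) z (v w : R * R) : differentiable h z ->
  det2 ('D_v h z) ('D_w h z) =
  det2 v w * det2 ('D_((1, 0) : R * R) h z) ('D_((0, 1) : R * R) h z).
Proof.
move=> dh; have E (u : R * R) : 'D_u h z =
    u.1 *: ('D_((1, 0) : R * R) h z) + u.2 *: ('D_((0, 1) : R * R) h z).
  rewrite !deriveE // -!linearZ -linearD; congr ('d h z _).
  apply: injective_projections => /=; rewrite /GRing.scale/=.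
    by rewrite mulr1 mulr0 addr0.
  by rewrite mulr1 mulr0 add0r.
rewrite (E v) (E w) {E dh}.
move: ('D__ h z) ('D__ h z) => [a b] [c d]; case: v w => [e f] [g k].
by rewrite /det2 /= /GRing.scale/=; ring.
Qed.

Lemma velocity_comp (h : R * R -> R * R) (g : R -> R * R) (phi : R -> R) s :
    differentiable h (g (phi s)) -> derivable g (phi s) 1 -> derivable phi s 1 ->
  velocity (h \o (g \o phi)) s =
  (phi^`() s)%classic *: 'D_(velocity g (phi s)) h (g (phi s)).
Proof.
move=> dh /derivable1_diffP dg dphi'; have /derivable1_diffP dphi := dphi'.
have dgp : differentiable (g \o phi) s by exact: differentiable_comp.
rewrite /velocity deriveE; last exact: differentiable_comp.
rewrite (deriveE _ dg) (deriveE _ dh).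
have E1 := congr1 (@^~ 1) (diff_comp dgp dh).
have E2 := congr1 (@^~ 1) (diff_comp dphi dg).
apply: (etrans E1); rewrite /= in E2 *.
apply: (etrans (congr1 ('d h (g (phi s))) E2)).
rewrite -(derive1E' dphi).
have {1}-> : (phi^`() s)%classic = (phi^`() s)%classic *: (1 : R).
  by rewrite /GRing.scale/= mulr1.
by rewrite !linearZ.
Qed.

End Isotopy.

Section IsotopyInvariance.
Variables (R : realType) (n : nat).
Implicit Types (D : diagram R n) (p q : source R n).

Lemma reparam_mono (phi : R -> R) : reparam false phi ->
  {mono phi : x y / x <= y}.
Proof.
case=> dphi _ phi_gt0 _; apply: le_mono => x y xy.
apply: (@gtr0_derive1_incr _ phi x y) => //.
by apply: continuous_subspaceT => z; exact/differentiable_continuous/derivable1_diffP.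
Qed.

Lemma reparam_onto (phi : R -> R) t : reparam false phi -> 0 <= t <= 1 ->
  exists2 s, 0 <= s <= 1 & phi s = t.
Proof.
case=> dphi _ _ [phi0 phi1] /andP[t0 t1].
have [||s] := @IVT R phi 0 1 t ler01.
- by apply: continuous_subspaceT => z; exact/differentiable_continuous/derivable1_diffP.
- by rewrite phi0 phi1 min_l ?max_r ?ler01 ?t0.
by rewrite in_itv => s01 <-; exists s.
Qed.

Lemma in_dom_long D p : long D -> in_dom D p <-> 0 <= p.2 <= 1.
Proof.
by move=> lD; rewrite /in_dom /param_dom (negPf (lD p.1)) /=; split=> [[-> ->]|/andP[]].
Qed.

Lemma sgz_det2_isotopy (H : R -> R * R -> R * R) z (a b : R) (v w : R * R) :
    planar_isotopy H -> open_square z -> 0 < a -> 0 < b ->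
  sgz (det2 (a *: 'D_v (H 1) z) (b *: 'D_w (H 1) z)) = sgz (det2 v w).
Proof.
move=> iH oz a0 b0; have J0 := isotopy_det_gt0 iH oz; have [[_ dH _] _ _] := iH.
have detZ (v' w' : R * R) : det2 (a *: v') (b *: w') = a * b * det2 v' w'.
  by case: v' w' => [v1 v2] [w1 w2]; rewrite /det2 /= /GRing.scale/=; ring.
rewrite detZ (det2_derive _ _ (dH 1 z)) !sgzM.
by rewrite (gtr0_sgz J0) (gtr0_sgz a0) (gtr0_sgz b0) !mul1r mulr1.
Qed.

(** A strand has no base point to move, so the increasing reparametrizations
    preserve the relation of lying between two parameters. *)
Lemma isotopic_invariant (V : zmodType) (F : 'I_n -> 'I_n -> int -> int -> V) D D' :
  long D -> isotopic D D' -> gauss_sum F D = gauss_sum F D'.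
Proof.
move=> lD [H [phi [iH rphi cl pos ov]]].
have lD' : long D' by move=> i; rewrite cl.
have {}rphi i : reparam false (phi i) by have := rphi i; rewrite (negPf (lD i)).
have phi_le i := reparam_mono (rphi i); have phi_lt i := leW_mono (phi_le i).
pose rho p : source R n := (p.1, phi p.1 p.2).
have wrapE p : (p.1, wrap (is_closed D p.1) (phi p.1 p.2)) = rho p.
  by rewrite (negPf (lD _)).
have phi0 i : phi i 0 = 0 by have [_ _ _ []] := rphi i.
have phi1 i : phi i 1 = 1 by have [_ _ _ []] := rphi i.
have domE p : in_dom D' p <-> in_dom D (rho p).
  by rewrite !in_dom_long //= -{2}(phi0 p.1) -{2}(phi1 p.1) !phi_le.
have rhoK p q : rho p = rho q -> p = q.
  case: p q => [i x] [j y] /= [-> /eqP]; rewrite eq_le !phi_le -eq_le => /eqP ->//.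
have overE p q : in_dom D' p -> in_dom D' q ->
    (over D' (p, q) <-> over D (rho p, rho q)).
  by move=> hp hq; rewrite (ov p q hp hq) !wrapE.
pose rho2 (c : source R n * source R n) := (rho c.1, rho c.2).
have rho2K : injective rho2.
  move=> x y e; apply: injective_projections; apply: rhoK.
    exact: (congr1 fst e).
  exact: (congr1 snd e).
have overD : over D = rho2 @` over D'.
  apply/seteqP; split=> [[p q] o|_ [[p q] o <-]]; last first.
    by have [hp hq _ _] := over_double o; exact/overE.
  have [/(in_dom_long p lD) hp /(in_dom_long q lD) hq _ _] := over_double o.
  have [s s01 es] := reparam_onto (rphi p.1) hp.
  have [t t01 et] := reparam_onto (rphi q.1) hq.
  have e : rho2 ((p.1, s), (q.1, t)) = (p, q).
    by rewrite /rho2 /rho /= es et -!surjective_pairing.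
  exists ((p.1, s), (q.1, t)) => //; apply/overE; try exact/in_dom_long.
  by rewrite -/(rho2 (_, _)) e.
have dirE p : 0 < p.2 < 1 ->
    dir D' p = ((phi p.1)^`() p.2)%classic *:
      'D_(dir D (rho p)) (H 1) (position D (rho p)).
  move=> p01; have [[_ dH _] _ _] := iH.
  have [dg _] := crv_C1 D p.1; have [dphi _ _ _] := rphi p.1.
  apply: etrans (velocity_comp (dH 1 _) (dg _) (dphi _)).
  apply: near_eq_derive; have := near_in_itvoo (a := 0) (b := 1) (x := p.2).
  rewrite in_itv/= => /(_ p01); apply: filterS => s; rewrite in_itv/= => /andP[s0 s1].
  have := pos (p.1, s); rewrite wrapE; apply; apply/in_dom_long => //=.
  by rewrite !ltW.
have csgnE p q : over D' (p, q) -> csgn D' p q = csgn D (rho p) (rho q).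
  move=> o; have dpq := over_double o; have dqp := double_sym dpq.
  have hp := double_interior_param lD' dpq.
  have hq := double_interior_param lD' dqp.
  have [ip iq _ _] := dpq.
  have dr : double_at D (rho p) (rho q) by apply/over_double/overE.
  have [_ _ _ epq] := dr.
  have op : open_square (position D (rho p)) := double_interior dr.
  have [_ _ p_gt0 _] := rphi p.1; have [_ _ q_gt0 _] := rphi q.1.
  have E : dir D' q = ((phi q.1)^`() q.2)%classic *:
      'D_(dir D (rho q)) (H 1) (position D (rho p)).
    by rewrite [position D (rho p)]epq; exact: dirE.
  rewrite /csgn (dirE p hp) E; exact: sgz_det2_isotopy.
have sumE (W : zmodType) (G : source R n * source R n -> W) :
    \sum_(c \in over D) G c = \sum_(c \in over D') G (rho2 c).
  by rewrite overD fsum_image // => x y _ _; exact: rho2K.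
have indexE c : over D' c -> gauss_index D (rho2 c) = gauss_index D' c.
  move=> oc; apply: (etrans (sumE _ _)).
  apply: eq_fsum => -[p q] o; rewrite /pairing /=.
  case: and3P => // -[/eqP e1 /eqP e2 /eqP e3].
  have bE x : x.1 = c.1.1 -> between (rho2 c) (rho x) = between c x.
    by move=> ex; rewrite /between /= e1 ex !phi_lt.
  by rewrite csgnE // !bE.
apply: (etrans (sumE _ _)).
apply: eq_fsum => -[p q] o.
exact: (congr2 (F p.1 q.1) (indexE (p, q) o) (esym (csgnE p q o))).
Qed.

End IsotopyInvariance.

(** * Moves inside a disc *)

Section Arcs.
Variables (R : realType) (n k : nat) (A : 'I_k -> 'I_n * (R * R)).
Implicit Types (p q x y z : source R n) (c : source R n * source R n) (m : 'I_k).

(** The crossings that a move supported on the arcs A does not touch. *)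
Definition outside : set (source R n * source R n) :=
  [set c | ~ in_arcs A c.1 /\ ~ in_arcs A c.2].

(** An interval lies on one side of each point outside it.  The next lemmas say
    what this means for chords with an end in an arc. *)
Lemma arc_lt m p p' q : in_arc A m p -> in_arc A m p' -> ~ in_arc A m q ->
  q.1 = p.1 -> (p.2 < q.2) = (p'.2 < q.2) /\ (q.2 < p.2) = (q.2 < p'.2).
Proof.
move=> [e /andP[h1 h2]] [e' /andP[h3 h4]] hq eq.
have : (q.2 < (A m).2.1) || ((A m).2.2 < q.2).
  rewrite !ltNge -negb_and; apply/negP => /andP[h5 h6]; apply: hq.
  by split; [rewrite eq | rewrite h5 h6].
by case/orP => h; split; apply/idP/idP; lra.
Qed.

Lemma between_arc m c p p' : in_arc A m p -> in_arc A m p' ->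
    ~ in_arc A m c.1 -> ~ in_arc A m c.2 -> c.1.1 = p.1 -> c.2.1 = p.1 ->
  between c p = between c p'.
Proof.
move=> hp hp' n1 n2 e1 e2; rewrite /between.
have [-> ->] := arc_lt hp hp' n1 e1; by have [-> ->] := arc_lt hp hp' n2 e2.
Qed.

Lemma between_ends m1 m2 c c' p : in_arc A m1 c.1 -> in_arc A m1 c'.1 ->
    in_arc A m2 c.2 -> in_arc A m2 c'.2 -> ~ in_arc A m1 p -> ~ in_arc A m2 p ->
    p.1 = c.1.1 -> p.1 = c.2.1 ->
  between c p = between c' p.
Proof.
move=> h1 h1' h2 h2' n1 n2 e1 e2; rewrite /between.
have [-> ->] := arc_lt h1 h1' n1 e1; by have [-> ->] := arc_lt h2 h2' n2 e2.
Qed.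

Lemma betweenC x y z : between (x, y) z = between (y, x) z.
Proof. by rewrite /between orbC. Qed.

(** Seen from the start x of a chord whose other end y is outside the arc, the
    chord covers the part of the arc on the side of y. *)
Lemma between_sgz m x y z : in_arc A m x -> in_arc A m z -> ~ in_arc A m y ->
    y.1 = x.1 -> z.2 != x.2 ->
  2 * (between (x, y) z : nat)%:Z = 1 + sgz (y.2 - x.2) * sgz (z.2 - x.2).
Proof.
move=> hx hz ny e zx; rewrite /between /=.
have [exz ezx] := arc_lt hx hz ny e.
have [xy|yx|xy] := ltgtP x.2 y.2; last first.
- exfalso; apply: ny; case: hx => h1 h2; split; first by rewrite e.
  by rewrite -xy.
- rewrite ezx in yx; rewrite yx (ltNge z.2 y.2) (ltW yx) andbF /=.
  have -> : sgz (y.2 - x.2) = -1 by rewrite ltr0_sgz // subr_lt0 ezx.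
  have [zx'|xz|xz] := ltgtP z.2 x.2.
  + by rewrite ltr0_sgz // subr_lt0.
  + by rewrite gtr0_sgz // subr_gt0.
  + by rewrite xz eqxx in zx.
- have xy' := xy; rewrite exz in xy'; rewrite xy' (ltNge y.2 z.2) (ltW xy') andbT /= orbF.
  have -> : sgz (y.2 - x.2) = 1 by rewrite gtr0_sgz // subr_gt0.
  have [zx'|xz|xz] := ltgtP z.2 x.2.
  + by rewrite ltr0_sgz // subr_lt0.
  + by rewrite gtr0_sgz // subr_gt0.
  + by rewrite xz eqxx in zx.
Qed.

Lemma arc_sgz m x x' y : in_arc A m x -> in_arc A m x' -> ~ in_arc A m y ->
  y.1 = x.1 -> sgz (y.2 - x.2) = sgz (y.2 - x'.2).
Proof.
move=> hx hx' ny e; have [e1 e2] := arc_lt hx hx' ny e.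
have [xy|yx|xy] := ltgtP x.2 y.2.
- by rewrite !gtr0_sgz // subr_gt0 // -e1.
- by rewrite !ltr0_sgz // subr_lt0 // -e2.
- exfalso; apply: ny; case: hx => h1 h2; split; first by rewrite e.
  by rewrite -xy.
Qed.

End Arcs.

Section LocalMove.
Variables (R : realType) (n k : nat) (A : 'I_k -> 'I_n * (R * R)).
Variables (D D' : diagram R n).
Hypotheses (lD : long D) (so : same_outside A D D').
Implicit Types (p q x y z : source R n) (c d : source R n * source R n) (m : 'I_k).

Lemma over_outside : over D `&` outside A = over D' `&` outside A.
Proof.
by case: so => _ _ _ _ eqo; apply/seteqP; split=> -[p q] [oc [np nq]];
  split=> //; apply/eqo.
Qed.

(** The arcs are closed, so the curves agree on a neighbourhood of the
    parameter. *)
Lemma dir_outside p : 0 < p.2 < 1 -> ~ in_arcs A p -> dir D' p = dir D p.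
Proof.
move=> p01 np; case: so => _ _ _ [z [r [_ _ _ pos]]] _.
apply: near_eq_derive.
have near01 : \forall s \near p.2, 0 < s < 1.
  have := near_in_itvoo (a := 0) (b := 1) (x := p.2).
  by rewrite in_itv/= => /(_ p01); apply: filterS => s; rewrite in_itv.
have nearA : \forall s \near p.2, forall m, ~ in_arc A m (p.1, s).
  apply: (@filter_forall _ _ (fun m => [set s | ~ in_arc A m (p.1, s)]) (nbhs p.2)) => m.
  have [e|ne] := eqVneq p.1 (A m).1; last first.
    by apply: nearW => s [e _]; rewrite /= in e; rewrite e eqxx in ne.
  have : (p.2 < (A m).2.1) || ((A m).2.2 < p.2).
    rewrite !ltNge -negb_and; apply/negP => /andP[h5 h6]; apply: np.
    by exists m; split; rewrite ?h5.
  case/orP => h.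
    by apply: filterS (lt_nbhsl h) => s s_cases [_ /andP[]]; rewrite leNgt s_cases.
  have := near_in_itvoy (a := (A m).2.2) (x := p.2); rewrite in_itv/= andbT.
  move=> /(_ h); apply: filterS => s; rewrite in_itv/= andbT => s_cases [_ /andP[_]].
  by rewrite leNgt s_cases.
apply: filterS2 near01 nearA => s s01 nA.
have [||//] := pos (p.1, s); last by case=> m; exact: nA.
by apply/(in_dom_long _ lD); case/andP: s01 => s0 s1; rewrite /= !ltW.
Qed.

Lemma csgn_outside c : over D c -> outside A c ->
  csgn D' c.1 c.2 = csgn D c.1 c.2.
Proof.
case: c => p q oc [np nq]; have dpq := over_double oc.
have hp := double_interior_param lD dpq.
have hq := double_interior_param lD (double_sym dpq).
by rewrite /csgn (dir_outside hp np) (dir_outside hq nq).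
Qed.

End LocalMove.

Lemma fsum_seq (R : realType) (n : nat) (V : zmodType)
    (s : seq (source R n * source R n)) (F : source R n * source R n -> V) :
  uniq s -> \sum_(x \in [set` s]) F x = \sum_(x <- s) F x.
Proof. by move=> us; exact/esym/fsbig_seq. Qed.

Section Pairings.
Variables (R : realType) (n k : nat) (A : 'I_k -> 'I_n * (R * R)).
Implicit Types (D : diagram R n) (p q x y z : source R n).
Implicit Types (c d : source R n * source R n) (m : 'I_k).

(** A chord touched by a move and its counterpart: corresponding ends lie in
    the same arc. *)
Definition same_arcs c c' := exists m1 m2,
  [/\ in_arc A m1 c.1, in_arc A m1 c'.1, in_arc A m2 c.2 & in_arc A m2 c'.2].

Lemma same_arcs_comp c c' : same_arcs c c' -> c.1.1 = c'.1.1 /\ c.2.1 = c'.2.1.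
Proof. by case=> m1 [m2 [[-> _] [-> _] [-> _] [-> _]]]. Qed.

Lemma pairing_diag D c : pairing D c c = 0.
Proof.
rewrite /pairing; case: ifP => // _; rewrite /between !ltxx !andbF /=.
by rewrite ?andbF /= subrr mulr0.
Qed.

Lemma pairing_same_ends D c c' d : same_arcs c c' -> outside A d ->
  pairing D c d = pairing D c' d.
Proof.
move=> cc' [nd1 nd2]; have [e1 e2] := same_arcs_comp cc'.
case: cc' => m1 [m2 [h1 h1' h2 h2']].
rewrite /pairing -e1 -e2; case: and3P => [[/eqP e /eqP ed1 /eqP ed2]|_]; last exact: erefl.
have n1 m : ~ in_arc A m d.1 by move=> h; apply: nd1; exists m.
have n2 m : ~ in_arc A m d.2 by move=> h; apply: nd2; exists m.
by rewrite !(between_ends h1 h1' h2 h2') // ?ed1 ?ed2 ?e.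
Qed.

(** A chord untouched by the move cannot distinguish the points of an arc, so
    it links d and d' with the same weight up to their signs. *)
Lemma pairing_same_arcs D D' c d d' : same_arcs d d' -> outside A c ->
  exists w : int, pairing D c d = csgn D d.1 d.2 * w /\
                  pairing D' c d' = csgn D' d'.1 d'.2 * w.
Proof.
move=> dd' [nc1 nc2]; have [e1 e2] := same_arcs_comp dd'.
case: dd' => m1 [m2 [h1 h1' h2 h2']].
rewrite /pairing -e1 -e2; case: and3P => [[/eqP e /eqP ed1 /eqP ed2]|_]; last first.
  by exists 0; split; exact: esym (mulr0 _).
have n1 m : ~ in_arc A m c.1 by move=> h; apply: nc1; exists m.
have n2 m : ~ in_arc A m c.2 by move=> h; apply: nc2; exists m.
rewrite (between_arc h1 h1') ?(between_arc h2 h2') ?e ?ed1 ?ed2 //.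
by eexists; split; exact: erefl.
Qed.

Lemma pairing_chord_in_arc D m c d : in_arc A m d.1 -> in_arc A m d.2 -> outside A c ->
  pairing D c d = 0.
Proof.
move=> h1 h2 [nc1 nc2]; rewrite /pairing.
case: and3P => [[/eqP e /eqP ed1 /eqP ed2]|_]; last exact: erefl.
have n1 : ~ in_arc A m c.1 by move=> h; apply: nc1; exists m.
have n2 : ~ in_arc A m c.2 by move=> h; apply: nc2; exists m.
by rewrite (between_arc h1 h2 n1 n2) ?e ?ed1 ?subrr ?mulr0.
Qed.

Lemma pairing_arc_chord D m c d : in_arc A m c.1 -> in_arc A m c.2 -> outside A d ->
  pairing D c d = 0.
Proof.
move=> h1 h2 [nd1 nd2]; rewrite /pairing.
case: and3P => [[/eqP e /eqP ed1 /eqP ed2]|_]; last exact: erefl.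
have bF z : ~ in_arcs A z -> z.1 = c.1.1 -> between c z = false.
  move=> nz ez; have nm : ~ in_arc A m z by move=> h; apply: nz; exists m.
  rewrite (between_ends (c' := (c.1, c.1)) h1 h1 h2 h1) ?e //.
  by rewrite /between orbb; apply/negbTE/negP => /andP[/lt_trans h /h]; rewrite ltxx.
by rewrite !bF ?subrr ?mulr0.
Qed.

Lemma gauss_index_split D s c : uniq s -> over D `&` ~` outside A = [set` s] ->
  gauss_index D c = \sum_(d \in over D `&` outside A) pairing D c d +
              \sum_(d <- s) pairing D c d.
Proof.
move=> us es; apply: etrans (fsumID (outside A) _ (over_finite D)) _.
by congr (_ + _); rewrite es; exact: fsum_seq.
Qed.

Lemma gauss_sum_split (V : zmodType) (F : 'I_n -> 'I_n -> int -> int -> V) D s :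
    uniq s -> over D `&` ~` outside A = [set` s] ->
  gauss_sum F D =
    \sum_(c \in over D `&` outside A) F c.1.1 c.2.1 (gauss_index D c) (csgn D c.1 c.2) +
    \sum_(c <- s) F c.1.1 c.2.1 (gauss_index D c) (csgn D c.1 c.2).
Proof.
move=> us es; apply: etrans (fsumID (outside A) _ (over_finite D)) _.
by congr (_ + _); rewrite es; exact: fsum_seq.
Qed.

End Pairings.

Section LocalSums.
Variables (R : realType) (n k : nat) (A : 'I_k -> 'I_n * (R * R)).
Variables (D D' : diagram R n).
Hypotheses (lD : long D) (so : same_outside A D D').
Implicit Types (c d : source R n * source R n).
Variables s s' : seq (source R n * source R n).
Hypotheses (us : uniq s) (us' : uniq s').
Hypothesis es : over D `&` ~` outside A = [set` s].
Hypothesis es' : over D' `&` ~` outside A = [set` s'].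

Lemma outer_pairings c c' : c = c' \/ same_arcs A c c' ->
  \sum_(d \in over D `&` outside A) pairing D c d =
  \sum_(d \in over D' `&` outside A) pairing D' c' d.
Proof.
rewrite -(over_outside so) => cc'; apply: eq_fsum => d [od nd].
have -> : pairing D c d = pairing D c' d.
  by case: cc' => [->|cc']; rewrite // (pairing_same_ends _ cc').
by rewrite /pairing (csgn_outside lD so).
Qed.

Lemma gauss_index_local c c' : c = c' \/ same_arcs A c c' ->
  \sum_(d <- s) pairing D c d = \sum_(d <- s') pairing D' c' d ->
  gauss_index D c = gauss_index D' c'.
Proof.
move=> cc' e; rewrite (gauss_index_split c us es) (gauss_index_split c' us' es').
by rewrite (outer_pairings cc') e.
Qed.

(** Untouched crossings see the touched ones only through the arcs, and keep
    their mutual linking; so it remains to compare the touched crossings, listed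
    by s before the move and by s' after it. *)
Lemma gauss_sum_local (V : zmodType) (F : 'I_n -> 'I_n -> int -> int -> V) :
    (forall c, outside A c ->
      \sum_(d <- s) pairing D c d = \sum_(d <- s') pairing D' c d) ->
    \sum_(c <- s) F c.1.1 c.2.1 (gauss_index D c) (csgn D c.1 c.2) =
    \sum_(c <- s') F c.1.1 c.2.1 (gauss_index D' c) (csgn D' c.1 c.2) ->
  gauss_sum F D = gauss_sum F D'.
Proof.
move=> hout hin.
rewrite (gauss_sum_split F us es) (gauss_sum_split F us' es').
apply: (congr2 (fun u v : V => u + v) _ hin).
rewrite -(over_outside so); apply: eq_fsum => c [oc nc].
exact: (congr2 (F c.1.1 c.2.1) (gauss_index_local (or_introl (erefl c)) (hout c nc))
  (esym (csgn_outside lD so oc nc))).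
Qed.

End LocalSums.

Lemma over_empty (R : realType) (n k : nat) (A : 'I_k -> 'I_n * (R * R))
    (D : diagram R n) :
  (forall p q, in_arcs A p -> ~ double_at D p q) ->
  over D `&` ~` outside A = [set` [::]].
Proof.
move=> nd; apply/seteqP; split=> // -[p q] [oc no]; exfalso; apply: no.
have dpq := over_double oc.
by split=> h; [apply: (nd p q h) | apply: (nd q p h); exact: double_sym].
Qed.

(** The form taken by the comparison when the move removes all the crossings
    in the disc. *)
Lemma gauss_sum_collapse (R : realType) (n k : nat) (A : 'I_k -> 'I_n * (R * R))
    (D D' : diagram R n) (s : seq (source R n * source R n))
    (V : zmodType) (F : 'I_n -> 'I_n -> int -> int -> V) :
    long D -> same_outside A D D' ->
    (forall p q, in_arcs A p -> ~ double_at D' p q) ->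
    uniq s -> over D `&` ~` outside A = [set` s] ->
    (forall c, outside A c -> \sum_(d <- s) pairing D c d = 0) ->
    \sum_(c <- s) F c.1.1 c.2.1 (gauss_index D c) (csgn D c.1 c.2) = 0 ->
  gauss_sum F D = gauss_sum F D'.
Proof.
move=> lD so nd us es hout hin.
apply: (gauss_sum_local (s' := [::]) lD so us isT es (over_empty nd)).
  by move=> c nc; apply: etrans (hout c nc) _; rewrite big_nil.
by apply: etrans hin _; rewrite big_nil.
Qed.

Section Moves.
Variables (R : realType) (n : nat).
Implicit Types (D : diagram R n) (p q x y z : source R n).
Implicit Types (c d : source R n * source R n).

Section Weights.
Variables (V : zmodType) (F : 'I_n -> 'I_n -> int -> int -> V).
Hypothesis F0 : forall i e, F i i 0 e = 0.
Hypothesis FN : forall i j w e, F i j w (- e) = - F i j w e.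

(** The kink may be virtual, or classical with either strand on top. *)
Lemma over_inner1 k (A : 'I_k -> 'I_n * (R * R)) D p q :
    in_arcs A p -> in_arcs A q ->
    (forall p' q', in_arcs A p' -> double_at D p' q' ->
      (p', q') = (p, q) \/ (p', q') = (q, p)) ->
  exists s, [/\ uniq s, over D `&` ~` outside A = [set` s] &
    s = [::] \/ exists c, [/\ s = [:: c], over D c & c = (p, q) \/ c = (q, p)]].
Proof.
move=> ap aq only_pq.
have inner c : over D c -> ~ outside A c -> c = (p, q) \/ c = (q, p).
  case: c => x y oc no; have dxy := over_double oc.
  case: (pselect (in_arcs A x)) => [/(only_pq x y)|nx]; first by apply.
  case: (pselect (in_arcs A y)) => [/(only_pq y x)|ny]; last by exfalso; apply: no.
  by move=> /(_ (double_sym dxy)) [] [-> ->]; [right | left].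
have nout x y : in_arcs A x -> ~ outside A (x, y) by move=> ax [].
have [ov1|n1] := pselect (over D (p, q)).
  exists [:: (p, q)]; split=> //; last by right; exists (p, q); split=> //; left.
  apply/seteqP; split=> c /=; rewrite inE; last by move/eqP ->; split=> //; exact: nout.
  by move=> [oc /(inner c oc) [->//|e]]; case: (over_asym ov1); rewrite -e.
have [ov2|n2] := pselect (over D (q, p)).
  exists [:: (q, p)]; split=> //; last by right; exists (q, p); split=> //; right.
  apply/seteqP; split=> c /=; rewrite inE; last by move/eqP ->; split=> //; exact: nout.
  by move=> [oc /(inner c oc) [e|->//]]; case: n1; rewrite -e.
exists [::]; split=> //; last by left.
apply/seteqP; split=> // c [oc /(inner c oc) [e|e]].
  by case: n1; rewrite -e.
by case: n2; rewrite -e.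
Qed.

(** Between the two ends of the kink there is no other crossing, so its index
    is zero; and both ends are on the same side of any other crossing. *)
Lemma move1_invariant D D' : long D -> move1 D D' -> gauss_sum F D = gauss_sum F D'.
Proof.
move=> lD [A [so nd' [p [q [ap aq dpq only_pq]]]]].
have [s [us es s_cases]] := over_inner1 ap aq only_pq.
have arc0 x : in_arcs A x -> in_arc A ord0 x by case=> m; rewrite (ord1 m).
have kink d : d = (p, q) \/ d = (q, p) -> in_arc A ord0 d.1 /\ in_arc A ord0 d.2.
  by case=> ->; split; exact: arc0.
apply: (gauss_sum_collapse lD so nd' us es).
  move=> c nc; case: s_cases => [->|[d [-> od /kink[d1 d2]]]]; first by rewrite big_nil.
  by rewrite big_seq1 (pairing_chord_in_arc _ d1 d2 nc).
case: s_cases => [->|[d [se od /kink[d1 d2]]]]; first by rewrite big_nil.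
have d0 : gauss_index D d = 0.
  rewrite (gauss_index_split d us es) se big_seq1 pairing_diag addr0.
  by apply: fsbig1 => c [_ nc]; exact: pairing_arc_chord d1 d2 nc.
by rewrite se big_seq1 d0; case: d1 d2 => [-> _] [-> _].
Qed.

(** The two crossings of the bigon have opposite signs, so their contributions
    to any other index cancel; those to [gauss_sum] cancel as soon as their
    indices agree.  The other chords cannot tell them apart, and each links the
    other by the same amount: exchanging them reverses both the linking and the
    sign that weights it. *)
Lemma move2_invariant D D' : long D -> move2 D D' -> gauss_sum F D = gauss_sum F D'.
Proof.
move=> lD [A [so nd' [p1 [q1 [p2 [q2 [[hp1 hp2 hq1 hq2] [p12 [d1 d2]] hin sg kind]]]]]]].
have inner c : over D c -> ~ outside A c ->
    c \in [:: (p1, q1); (q1, p1); (p2, q2); (q2, p2)].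
  case: c => x y oc no; have dxy := over_double oc.
  case: (pselect (in_arcs A x)) => [/(hin x y)|nx]; first by apply.
  case: (pselect (in_arcs A y)) => [/(hin y x)|ny]; last by exfalso; apply: no.
  move=> /(_ (double_sym dxy)); rewrite !inE /= !xpair_eqE.
  by case/or4P => /andP[-> ->]; rewrite ?orbT.
have disj : forall m m' x, in_arc A m x -> in_arc A m' x -> m = m' by case: so.
have p12b : p1 != p2 by apply/eqP.
case: kind => [[ov1 ov2]|[[_ nv1] [_ nv2]]]; last first.
  have es : over D `&` ~` outside A = [set` [::]].
    apply/seteqP; split=> // c [oc /(inner c oc)]; rewrite !inE.
    by case/or4P => /eqP e; exfalso; rewrite e in oc;
      [apply: nv1; left | apply: nv1; right | apply: nv2; left | apply: nv2; right].
  apply: (gauss_sum_collapse (s := [::]) lD so nd' isT es) => [c _|];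
    exact: big_nil.
pose s := [:: (p1, q1); (p2, q2)].
have us : uniq s by rewrite /= inE xpair_eqE (negPf p12b).
have es : over D `&` ~` outside A = [set` s].
  apply/seteqP; split=> c /=.
    move=> [oc /(inner c oc)]; rewrite /s !inE.
    case/or4P => /eqP e; rewrite e ?eqxx ?orbT //; exfalso; rewrite e in oc.
    - exact: over_asym ov1 oc.
    - exact: over_asym ov2 oc.
  rewrite /s !inE => /orP[] /eqP ->; (split; first by []) => -[no _]; apply: no.
  - by exists ord0.
  - by exists ord0.
have sa : same_arcs A (p1, q1) (p2, q2) by exists ord0, ord_max.
have [e1 e2] := same_arcs_comp sa; rewrite /= in e1 e2.
have pairN c : outside A c -> pairing D c (p1, q1) + pairing D c (p2, q2) = 0.
  move=> nc; have [w [-> ->]] := pairing_same_arcs D D sa nc.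
  by rewrite /= sg mulNr addNr.
have ei : gauss_index D (p1, q1) = gauss_index D (p2, q2).
  rewrite !(gauss_index_split _ us es) !big_cons !big_nil !pairing_diag !addr0 add0r.
  congr (_ + _); first by apply: eq_fsum => d [_ nd]; exact: pairing_same_ends sa nd.
  have nq x : in_arc A ord_max x -> ~ in_arc A ord0 x by move=> h /disj/(_ h).
  have np x : in_arc A ord0 x -> ~ in_arc A ord_max x by move=> h /disj/(_ h).
  have q12 : q1 <> q2.
    move=> e; apply: p12; apply: no_triple (double_sym d1) _.
    by rewrite e; exact: double_sym.
  have ne x y : x.1 = y.1 -> x <> y -> x.2 != y.2.
    by case: x y => [x1 x2] [y1 y2] /= -> h; apply/eqP => e; apply: h; rewrite e.
  rewrite /pairing /= -e1 -e2 !eqxx /= andbb.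
  have [eqp|//] := eqVneq q1.1 p1.1; rewrite /= sg mulNr -mulrN; congr (_ * _).
  have B1 := between_sgz hp1 hp2 (nq _ hq1) eqp (ne _ _ (esym e1) (nesym p12)).
  have B2 := between_sgz hq1 hq2 (np _ hp1) (esym eqp) (ne _ _ (esym e2) (nesym q12)).
  have eqp2 : q2.1 = p2.1 by rewrite -e1 -e2.
  have B3 := between_sgz hp2 hp1 (nq _ hq2) eqp2 (ne _ _ e1 p12).
  have B4 := between_sgz hq2 hq1 (np _ hp2) (esym eqp2) (ne _ _ e2 q12).
  rewrite betweenC in B2; rewrite betweenC in B4.
  have O1 := arc_sgz hp1 hp2 (nq _ hq1) eqp.
  have O2 := arc_sgz hq1 hq2 (np _ hp2) (etrans (esym e1) (esym eqp)).
  have sN (a b : R) : sgz (a - b) = - sgz (b - a) by rewrite -sgzN opprB.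
  rewrite (sN p1.2 q1.2) in B2; rewrite (sN q2.2 p2.2) -O2 (sN p2.2 q1.2) -O1 in B3.
  rewrite -O2 (sN p2.2 q1.2) -O1 (sN q1.2 q2.2) in B4; rewrite (sN p1.2 p2.2) in B3.
  clear - B1 B2 B3 B4; move: B1 B2 B3 B4.
  move: (between (p1, q1) p2) (between (p1, q1) q2) => b1 b2.
  move: (between (p2, q2) p1) (between (p2, q2) q1) => b3 b4.
  (* o is the order of the two arcs, P and Q the order of the crossings along
     each of them. *)
  by move: (sgz _) (sgz _) (sgz _) => o P Q; nia.
apply: (gauss_sum_collapse lD so nd' us es).
  by move=> c nc; rewrite big_cons big_seq1; exact: pairN.
rewrite big_cons big_seq1 /=.
have -> : csgn D p1 q1 = - csgn D p2 q2 by [].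
by rewrite FN ei e1 e2 addNr.
Qed.

End Weights.
End Moves.

Section Triangles.
Variables (R : realType) (n K : nat).
Variables (D D' : diagram R n) (A : 'I_K -> 'I_n * (R * R)).
Variables X X' : 'I_K -> 'I_K -> source R n.
Hypotheses (lD : long D) (so : same_outside A D D').
Hypothesis hX : forall k l, k <> l ->
  in_arc A k (X k l) /\ double_at D (X k l) (X l k).
Hypothesis hX' : forall k l, k <> l ->
  in_arc A k (X' k l) /\ double_at D' (X' k l) (X' l k).
Hypothesis only_X : forall p q, in_arcs A p -> double_at D p q ->
  exists k l, k <> l /\ (p, q) = (X k l, X l k).
Hypothesis only_X' : forall p q, in_arcs A p -> double_at D' p q ->
  exists k l, k <> l /\ (p, q) = (X' k l, X' l k).
Hypothesis same_sign : forall k l, k <> l ->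
  csgn D' (X' k l) (X' l k) = csgn D (X k l) (X l k).

Let crossing (Y : 'I_K -> 'I_K -> source R n) (kl : 'I_K * 'I_K) :=
  (Y kl.1 kl.2, Y kl.2 kl.1).

Lemma crossing_inj (E : diagram R n) (Y : 'I_K -> 'I_K -> source R n)
    (ks : seq ('I_K * 'I_K)) :
  (forall k l, k <> l -> in_arc A k (Y k l) /\ double_at E (Y k l) (Y l k)) ->
  (forall kl, kl \in ks -> kl.1 <> kl.2) -> {in ks &, injective (crossing Y)}.
Proof.
case: so => _ _ disj _ _ hY nks [k l] [k' l'] /nks /= kl /nks /= kl' [e1 e2].
have [a1 _] := hY _ _ kl; have [a1' _] := hY _ _ kl'.
have [a2 _] := hY _ _ (nesym kl); have [a2' _] := hY _ _ (nesym kl').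
rewrite e1 in a1; rewrite e2 in a2.
by rewrite (disj _ _ _ a1 a1') (disj _ _ _ a2 a2').
Qed.

Lemma over_crossings (E : diagram R n) (Y : 'I_K -> 'I_K -> source R n)
    (ks : seq ('I_K * 'I_K)) :
    (forall k l, k <> l -> in_arc A k (Y k l) /\ double_at E (Y k l) (Y l k)) ->
    (forall p q, in_arcs A p -> double_at E p q ->
      exists k l, k <> l /\ (p, q) = (Y k l, Y l k)) ->
    (forall kl, kl \in ks -> kl.1 <> kl.2) ->
    (forall k l, k <> l -> (over E (Y k l, Y l k) <-> (k, l) \in ks)) ->
  over E `&` ~` outside A = [set` map (crossing Y) ks].
Proof.
move=> hY onlyY nks oY; apply/seteqP; split=> [[p q] [oc no]|_ /mapP[[k l] hkl ->]].
  have dpq := over_double oc.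
  have [k [l [kl [ep eq]]]] : exists k l, k <> l /\ (p, q) = (Y k l, Y l k).
    case: (pselect (in_arcs A p)) => [/onlyY|np]; first by apply.
    case: (pselect (in_arcs A q)) => [/onlyY|nq]; last by exfalso; apply: no.
    move=> /(_ _ (double_sym dpq)) [k [l [kl [-> ->]]]].
    by exists l, k; split=> // /esym.
  apply/mapP; exists (k, l); last by rewrite ep eq.
  by apply/oY; rewrite -?ep -?eq.
have kl : k <> l := nks _ hkl.
split; first exact/oY.
by case=> nY _; apply: nY; exists k; have [] := hY _ _ kl.
Qed.

(** A move that matches the crossings in the disc bijectively, with the same
    signs, preserves weighted sums if the matched crossings are linked in the same
    way by the crossings in the disc.  The list ks names the classical ones. *)
Lemma gauss_sum_crossings (V : zmodType) (F : 'I_n -> 'I_n -> int -> int -> V)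
    (ks : seq ('I_K * 'I_K)) :
    uniq ks -> (forall kl, kl \in ks -> kl.1 <> kl.2) ->
    (forall k l, k <> l -> (over D (X k l, X l k) <-> (k, l) \in ks)) ->
    (forall k l, k <> l -> (over D' (X' k l, X' l k) <-> (k, l) \in ks)) ->
    (forall kl, kl \in ks ->
      \sum_(mn <- ks) pairing D (crossing X kl) (crossing X mn) =
      \sum_(mn <- ks) pairing D' (crossing X' kl) (crossing X' mn)) ->
  gauss_sum F D = gauss_sum F D'.
Proof.
move=> uks nks oX oX' hks.
have us : uniq (map (crossing X) ks).
  by rewrite map_inj_in_uniq //; exact: crossing_inj hX nks.
have us' : uniq (map (crossing X') ks).
  by rewrite map_inj_in_uniq //; exact: crossing_inj hX' nks.
have es := over_crossings hX only_X nks oX.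
have es' := over_crossings hX' only_X' nks oX'.
have sa kl : kl \in ks -> same_arcs A (crossing X kl) (crossing X' kl).
  move=> /nks h; exists kl.1, kl.2; have h' := nesym h.
  by split; [have [] := hX h | have [] := hX' h | have [] := hX h' | have [] := hX' h'].
have sg kl : kl \in ks ->
    csgn D (crossing X kl).1 (crossing X kl).2 =
    csgn D' (crossing X' kl).1 (crossing X' kl).2.
  by move=> /nks h; apply/esym/same_sign.
apply: (gauss_sum_local lD so us us' es es').
  move=> c nc; apply: etrans (big_map _ _ _) _; apply/esym.
  apply: etrans (big_map _ _ _) _; apply/esym.
  apply: eq_big_seq => kl hkl.
  have [w [-> ->]] := pairing_same_arcs D D' (sa kl hkl) nc.
  by rewrite (sg kl hkl).
apply: etrans (big_map _ _ _) _; apply/esym.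
apply: etrans (big_map _ _ _) _; apply/esym.
apply: eq_big_seq => kl hkl; rewrite -(sg kl hkl).
have [<- <-] := same_arcs_comp (sa kl hkl).
suff -> : gauss_index D (crossing X kl) = gauss_index D' (crossing X' kl) by exact: erefl.
apply: (gauss_index_local lD so us us' es es'); first by right; exact: sa.
apply: etrans (big_map _ _ _) _; apply/esym.
by apply: etrans (big_map _ _ _) _; apply/esym; exact: hks.
Qed.

End Triangles.

Section ThirdArc.
Variables (R : realType) (n K : nat) (D : diagram R n).
Variables (A : 'I_K -> 'I_n * (R * R)) (X : 'I_K -> 'I_K -> source R n).
Hypothesis disj : forall m m' p, in_arc A m p -> in_arc A m' p -> m = m'.
Hypothesis hX : forall k l, k <> l ->
  in_arc A k (X k l) /\ double_at D (X k l) (X l k).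

Let f k l := csgn D (X k l) (X l k).

Lemma pairing_swap c p q : pairing D c (p, q) = pairing D c (q, p).
Proof.
rewrite /pairing /= (csgnC D p q) mulNr -mulrN opprB.
by case: (c.2.1 == c.1.1) => //=; rewrite andbC.
Qed.

(** Let k and l cross at c, and let the third arc m cross both.  If all three
    are on one component, the position of X k m relative to X k l decides whether c
    links the crossing of k and m, and likewise for l.  Each position enters
    through a sign, with opposite orientations on the two arcs, and the balance
    hypothesis makes the two signs cancel; what is left depends only on the signs
    of the crossings and on whether m lies between k and l. *)
Lemma third_arc k l m : k <> l -> k <> m -> l <> m ->
    f k m * sgz ((X k m).2 - (X k l).2) = f l m * sgz ((X l m).2 - (X l k).2) ->
  2 * (pairing D (X k l, X l k) (X k m, X m k) +
       pairing D (X k l, X l k) (X l m, X m l)) =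
  if ((A l).1 == (A k).1) && ((A m).1 == (A k).1)
  then (f k m + f l m) * (1 - 2 * (between (X k l, X l k) (X m k) : nat)%:Z)
  else 0.
Proof.
move=> kl km lm bal.
have [akl dkl] := hX kl; have [akm dkm] := hX km; have [alm dlm] := hX lm.
have [alk dlk] := hX (nesym kl); have [amk dmk] := hX (nesym km).
have [aml dml] := hX (nesym lm).
have nin u v x : u <> v -> in_arc A u x -> ~ in_arc A v x.
  by move=> uv hu hv; apply: uv; exact: disj hu hv.
have comp u x : in_arc A u x -> x.1 = (A u).1 by case.
rewrite /pairing /= (comp _ _ akl) (comp _ _ alk) (comp _ _ akm) (comp _ _ amk).
rewrite (comp _ _ alm) (comp _ _ aml) eqxx /=.
case: (eqVneq (A l).1 (A k).1) => [elk|_] /=; last by rewrite addr0 mulr0.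
case: (eqVneq (A m).1 (A k).1) => [emk|_] /=; last by rewrite addr0 mulr0.
have ne u v w : u <> v -> u <> w -> v <> w -> (X u v).2 != (X u w).2.
  move=> uv uw vw; have [auv duv] := hX uv; have [auw duw] := hX uw.
  have [avu _] := hX (nesym uv); have [awu _] := hX (nesym uw).
  apply/eqP => e2; apply: vw.
  have e : X u v = X u w.
    by apply: injective_projections; rewrite // (comp _ _ auv) (comp _ _ auw).
  rewrite e in duv; rewrite (no_triple duw duv) in awu; exact/esym/(disj awu).
have B1 := between_sgz akl akm (nin _ _ _ (nesym kl) alk)
  (etrans (comp _ _ alk) (etrans elk (esym (comp _ _ akl)))) (ne k m l km kl (nesym lm)).
have B2 := between_sgz alk alm (nin _ _ _ kl akl)
  (esym (etrans (comp _ _ alk) (etrans elk (esym (comp _ _ akl)))))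
  (ne l m k lm (nesym kl) (nesym km)).
rewrite betweenC in B2.
have -> : between (X k l, X l k) (X m l) = between (X k l, X l k) (X m k).
  apply: (between_arc aml amk) => /=; try exact: nin akl; try exact: nin alk.
  - by rewrite (comp _ _ akl) (comp _ _ aml).
  - by rewrite (comp _ _ alk) (comp _ _ aml) elk.
rewrite -/(f k m) -/(f l m).
have sN : sgz ((X k l).2 - (X l k).2) = - sgz ((X l k).2 - (X k l).2).
  by rewrite -sgzN opprB.
(* o is the order of the arcs k and l; the products a s and b t are balanced. *)
rewrite sN in B2; move: B1 B2 bal; clear.
move: (f k m) (f l m) (between _ (X k m)) (between _ (X l m)).
move: (between _ (X m k)) => b3 a b b1 b2.
move: (sgz ((X l k).2 - _)) (sgz ((X k m).2 - _)) (sgz ((X l m).2 - _)).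
move=> o s t B1 B2 bal.
have E (x y z : int) : 2 * (a * (x - z) + b * (y - z)) =
    a * (2 * x) + b * (2 * y) - (a + b) * (2 * z) by ring.
rewrite E.
rewrite B1 B2.
have -> : a * (1 + o * s) = a + o * (a * s) by ring.
by rewrite bal; ring.
Qed.

End ThirdArc.

Section Move3.
Variables (R : realType) (n : nat).
Implicit Types D : diagram R n.

(** The right-hand side of [third_arc] does not see the order of the crossings
    along the arcs, which is what the third move changes. *)
Lemma third_arc_same K (A : 'I_K -> 'I_n * (R * R)) D D' X X' k l m :
    (forall m m' p, in_arc A m p -> in_arc A m' p -> m = m') ->
    (forall k l, k <> l -> in_arc A k (X k l) /\ double_at D (X k l) (X l k)) ->
    (forall k l, k <> l -> in_arc A k (X' k l) /\ double_at D' (X' k l) (X' l k)) ->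
    (forall k l, k <> l -> csgn D' (X' k l) (X' l k) = csgn D (X k l) (X l k)) ->
    k <> l -> k <> m -> l <> m ->
    csgn D (X k m) (X m k) * sgz ((X k m).2 - (X k l).2) =
      csgn D (X l m) (X m l) * sgz ((X l m).2 - (X l k).2) ->
    csgn D (X k m) (X m k) * sgz ((X' k m).2 - (X' k l).2) =
      csgn D (X l m) (X m l) * sgz ((X' l m).2 - (X' l k).2) ->
  pairing D (X k l, X l k) (X k m, X m k) + pairing D (X k l, X l k) (X l m, X m l) =
  pairing D' (X' k l, X' l k) (X' k m, X' m k) +
    pairing D' (X' k l, X' l k) (X' l m, X' m l).
Proof.
move=> disj hX hX' sg kl km lm bal bal'.
have T := third_arc disj hX kl km lm bal.
rewrite -(sg k m km) -(sg l m lm) in bal'.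
have T' := third_arc disj hX' kl km lm bal'.
apply: (@mulfI _ (2 : int)); first by [].
apply: etrans T _; apply: etrans _ (esym T').
case: ifP => // /andP[/eqP elk /eqP emk].
rewrite (sg k m km) (sg l m lm).
have [akl _] := hX _ _ kl; have [alk _] := hX _ _ (nesym kl).
have [amk _] := hX _ _ (nesym km).
have [akl' _] := hX' _ _ kl; have [alk' _] := hX' _ _ (nesym kl).
have [amk' _] := hX' _ _ (nesym km).
have nin u v x : u <> v -> in_arc A u x -> ~ in_arc A v x.
  by move=> uv hu hv; apply: uv; exact: disj hu hv.
have comp u x : in_arc A u x -> x.1 = (A u).1 by case.
suff -> : between (X k l, X l k) (X m k) = between (X' k l, X' l k) (X' m k).
  exact: erefl.
rewrite (between_arc (c := (X k l, X l k)) amk amk'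
    (nin _ _ _ km akl) (nin _ _ _ lm alk)); last 2 first.
- by rewrite /= (comp _ _ akl) (comp _ _ amk).
- by rewrite /= (comp _ _ alk) (comp _ _ amk) elk.
apply: (between_ends (c := (X k l, X l k)) (c' := (X' k l, X' l k)) akl akl' alk alk').
- exact: nin (nesym km) amk'.
- exact: nin (nesym lm) amk'.
- by rewrite /= (comp _ _ akl) (comp _ _ amk').
- by rewrite /= (comp _ _ alk) (comp _ _ amk') elk.
Qed.

(** The order of the crossings along each arc is eps times the sign of the
    opposite crossing, and this is the balance that [third_arc] needs, for eps as
    well as for - eps.  In the virtual and mixed cases at most one crossing of
    the triangle is classical, and it has nothing to be linked with. *)
Lemma move3_invariant (V : zmodType) (F : 'I_n -> 'I_n -> int -> int -> V) D D' :
  long D -> move3 D D' -> gauss_sum F D = gauss_sum F D'.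
Proof.
move=> lD [A [X [X' [eps [so _ [tr tr'] sg kind]]]]].
have disj : forall m m' p, in_arc A m p -> in_arc A m' p -> m = m' by case: so.
case: tr => hX onlyX [s0 s1 s2]; case: tr' => hX' onlyX' [s0' s1' s2'].
set o0 := inord 0 in s0 s1 s2 s0' s1' s2'.
set o1 := inord 1 in s0 s1 s2 s0' s1' s2'.
set o2 := inord 2 in s0 s1 s2 s0' s1' s2'.
have v0 : o0 = 0%N :> nat by rewrite inordK.
have v1 : o1 = 1%N :> nat by rewrite inordK.
have v2 : o2 = 2%N :> nat by rewrite inordK.
have ord3 (k : 'I_3) : [\/ k = o0, k = o1 | k = o2].
  by case: k => -[|[|[|//]]] h; [constructor 1 | constructor 2 | constructor 3];
    apply: val_inj; rewrite /= ?v0 ?v1 ?v2.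
have n01 : o0 <> o1 by move=> e; rewrite e v1 in v0.
have n02 : o0 <> o2 by move=> e; rewrite e v2 in v0.
have n12 : o1 <> o2 by move=> e; rewrite e v2 in v1.
have nb (x y : 'I_3) : x <> y -> (x == y) = false by move=> h; apply/eqP.
have sN (a b : R) : sgz (a - b) = - sgz (b - a) by rewrite -sgzN opprB.
rewrite /= !(sg _ _ n01) !(sg _ _ n02) !(sg _ _ n12) in s0' s1' s2'.
(* The balance of the triangle at each of its three crossings. *)
have bal1 (e a b : int) : a * (e * b) = b * (e * a) by ring.
have bal2 (e a b : int) : a * - (e * b) = - b * (e * a) by ring.
have bal3 (e a b : int) : - a * - (e * b) = - b * - (e * a) by ring.
case: kind => [cl|[virt mix]].
  have oX (Y : 'I_3 -> 'I_3 -> source R n) E :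
      (forall k l : 'I_3, (k < l)%N -> over E (Y k l, Y l k)) ->
      forall k l, k <> l ->
      (over E (Y k l, Y l k) <-> (k, l) \in [:: (o0, o1); (o0, o2); (o1, o2)]).
    move=> oE k l kl; rewrite !inE !xpair_eqE; split.
      by case: (ord3 k) (ord3 l) kl => -> [] -> // _; rewrite ?eqxx ?orbT //;
        move=> h; exfalso; apply: over_asym h _; apply: oE; rewrite ?v0 ?v1 ?v2.
    by case/or3P => /andP[/eqP -> /eqP ->]; apply: oE; rewrite ?v0 ?v1 ?v2.
  apply: (gauss_sum_crossings lD so hX hX' onlyX onlyX' sg F
    (ks := [:: (o0, o1); (o0, o2); (o1, o2)])).
  - by rewrite /= !inE !xpair_eqE !eqxx (nb _ _ n01) (nb _ _ n12) ?andbF.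
  - by move=> kl; rewrite !inE => /or3P[] /eqP -> /=.
  - by apply: oX => k l /cl[].
  - by apply: oX => k l /cl[].
  move=> kl; rewrite !inE => /or3P[] /eqP ->;
    rewrite 2!big_cons big_seq1; apply/esym; rewrite 2!big_cons big_seq1; apply/esym;
    rewrite /= !pairing_diag ?add0r ?addr0.
  - apply: (third_arc_same disj hX hX' sg n01 n02 n12).
      by rewrite s0 s1; exact: bal1.
    by rewrite s0' s1'; exact: bal1.
  - rewrite (pairing_swap D _ (X o1 o2)) (pairing_swap D' _ (X' o1 o2)).
    apply: (third_arc_same disj hX hX' sg n02 n01 (nesym n12)).
      by rewrite (csgnC D (X o2 o1)) (sN (X o0 o1).2) s0 s2; exact: bal2.
    by rewrite (csgnC D (X o2 o1)) (sN (X' o0 o1).2) s0' s2'; exact: bal2.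
  - rewrite (pairing_swap D _ (X o0 o1)) (pairing_swap D _ (X o0 o2)).
    rewrite (pairing_swap D' _ (X' o0 o1)) (pairing_swap D' _ (X' o0 o2)).
    apply: (third_arc_same disj hX hX' sg n12 (nesym n01) (nesym n02)).
      rewrite (csgnC D (X o1 o0)) (csgnC D (X o2 o0)).
      by rewrite (sN (X o1 o0).2) (sN (X o2 o0).2) s1 s2; exact: bal3.
    rewrite (csgnC D (X o1 o0)) (csgnC D (X o2 o0)).
    by rewrite (sN (X' o1 o0).2) (sN (X' o2 o0).2) s1' s2'; exact: bal3.
have e0 : ord0 = o0 by apply: val_inj; rewrite /= v0.
have only12 k l : k <> l -> over D (X k l, X l k) ->
    (k, l) = (o1, o2) \/ (k, l) = (o2, o1).
  move=> kl okl.
  have [k0|nk0] := pselect (k = ord0).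
    have [[_ nv] _] := virt l (fun e => kl (etrans k0 (esym e))).
    by exfalso; apply: nv; left; rewrite -k0.
  have [l0|nl0] := pselect (l = ord0).
    have [[_ nv] _] := virt k nk0.
    by exfalso; apply: nv; right; rewrite -l0.
  rewrite e0 in nk0 nl0.
  by case: (ord3 k) (ord3 l) kl nk0 nl0 => -> [] -> //; [left | right].
have [ks [uks nks oX]] : exists ks : seq ('I_3 * 'I_3),
    [/\ (size ks <= 1)%N, forall kl, kl \in ks -> kl.1 <> kl.2 &
    forall k l, k <> l -> (over D (X k l, X l k) <-> (k, l) \in ks)].
  have [ov1|nv1] := pselect (over D (X o1 o2, X o2 o1)).
    exists [:: (o1, o2)]; split=> // [kl|k l kl]; first by rewrite inE => /eqP ->.
    rewrite inE; split; last by move=> /eqP [-> ->].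
    move=> okl; case: (only12 k l kl okl) => [-> //|[ek el]].
    by rewrite ek el in okl; case: (over_asym ov1).
  have [ov2|nv2] := pselect (over D (X o2 o1, X o1 o2)).
    exists [:: (o2, o1)]; split=> // [kl|k l kl]; first by rewrite inE => /eqP -> /esym.
    rewrite inE; split; last by move=> /eqP [-> ->].
    by move=> okl; case: (only12 k l kl okl) => [[ek el]|-> //]; rewrite ek el in okl.
  exists [::]; split=> // k l kl; split=> // okl.
  by case: (only12 k l kl okl) => -[ek el]; rewrite ek el in okl.
apply: (gauss_sum_crossings lD so hX hX' onlyX onlyX' sg F
    (ks := ks)) => //.
- by case: ks uks {nks oX} => [|? []].
- by move=> k l kl; apply: iff_trans (mix k l kl) (oX k l kl).
case: ks uks {nks oX} => [|kl []] // _ kl'; rewrite inE => /eqP ->.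
by rewrite !big_seq1 !pairing_diag.
Qed.

End Move3.

(** * Invariance *)

Section Invariance.
Variables (R : realType).

(** All moves keep the type of each component, so the invariants may be
    followed along a chain of moves once one of its ends is long. *)
Lemma one_move_long n (D D' : diagram R n) : one_move D D' -> (long D <-> long D').
Proof.
have cl : one_move D D' -> is_closed D' =1 is_closed D.
  case=> [[H [phi [_ _ h _ _]]]|[A [[h _ _ _ _] _ _]]|[A [[h _ _ _ _] _ _]]|] //.
  by case=> A [X [X' [eps [[h _ _ _ _] _ _ _ _]]]].
by move=> /cl e; split=> l i; have := l i; rewrite e.
Qed.

Lemma one_move_gauss_sum n (V : zmodType) (F : 'I_n -> 'I_n -> int -> int -> V)
    (D D' : diagram R n) :
    (forall i w, F i i 0 w = 0) -> (forall i j w e, F i j w (- e) = - F i j w e) ->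
  long D -> one_move D D' -> gauss_sum F D = gauss_sum F D'.
Proof.
move=> F0 FN lD [].
- exact: isotopic_invariant.
- exact: move1_invariant.
- exact: move2_invariant.
- exact: move3_invariant.
Qed.

Lemma equivalent_gauss_sum n (V : zmodType) (F : 'I_n -> 'I_n -> int -> int -> V)
    (D D' : diagram R n) :
    (forall i w, F i i 0 w = 0) -> (forall i j w e, F i j w (- e) = - F i j w e) ->
  long D -> equivalent D D' -> gauss_sum F D = gauss_sum F D'.
Proof.
move=> F0 FN lD /asboolP eqv; suff [_ /(_ lD)] :
    (long D <-> long D') /\ (long D -> gauss_sum F D = gauss_sum F D') by [].
elim: eqv {lD} => {D D'} [D D' m|//|D D' _ [e h]|D D1 D2 _ [e h] _ [e' h']].
- by split=> [|lD]; [exact: one_move_long | exact: one_move_gauss_sum].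
- by split=> [|lD']; [exact: iff_sym | apply/esym/h/e].
split=> [|lD]; first exact: iff_trans e e'.
have lD1 := proj1 e lD.
exact: (etrans (h lD) (h' lD1)).
Qed.

Lemma psc_equivalent n (D D' : diagram R n) :
  long D -> equivalent D D' -> diag_psc D = diag_psc D'.
Proof.
move=> lD h; rewrite !diag_pscE; apply: equivalent_gauss_sum lD h => [i w|i j w e].
  by rewrite eqxx normr0 /expo monalgU0 subrr mul0rz.
by case: ifP => _; rewrite ?oppr0 // mulrNz.
Qed.

Lemma vlk_equivalent n (D D' : diagram R n) i j : i != j ->
  long D -> equivalent D D' -> vlk D i j = vlk D' i j.
Proof.
move=> /negPf ij lD h; rewrite !vlkE; apply: equivalent_gauss_sum lD h => [k w|k l w e].
  by case: eqP => //= ->; rewrite ij.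
by case: ifP => // _; rewrite oppr0.
Qed.

End Invariance.

(** * Tangles with prescribed linking numbers *)

Section WaveTangles.
Variable R : realType.

(** Two such curves with the same w and different amplitudes meet exactly when
    the cosine vanishes, at equal parameters. *)
Definition wave (a w s : R) : R * R := (2^-1 + a * cos (w * s), s).

Lemma is_derive_wave (a w s : R) :
  is_derive s 1 (fun s : R => 2^-1 + a * cos (w * s)) (- (a * w * sin (w * s))).
Proof.
have dw : is_derive s 1 ( *%R w) w.
  have h := is_deriveZ (f := @id R) w (x := s) (v := 1) (df := 1) (is_derive_id _ _).
  by apply: (is_derive_eq h); rewrite /GRing.scale/= mulr1.
have dc := @is_derive1_comp _ (@cos R) ( *%R w) s _ _ (is_derive_cos _) dw.
have dac := is_deriveZ a dc.
have dd := is_deriveD (is_derive_cst (2^-1 : R) s 1) dac.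
apply: (is_derive_eq dd); rewrite add0r /GRing.scale/=; ring.
Qed.

Lemma diff_wave (a w s : R) : is_derive s 1 (wave a w) (- (a * w * sin (w * s)), 1).
Proof.
have [d1 e1] := is_derive_wave a w s.
have /derivable1_diffP f1 := d1.
have /derivable1_diffP f2 : derivable (@id R) s 1 by exact: derivable_id.
have dp := differentiable_pair f1 f2.
apply: DeriveDef; first exact/derivable1_diffP.
rewrite deriveE //; apply: etrans (congr1 (@^~ 1) (diff_pair f1 f2)) _.
by rewrite /= -(deriveE _ f1) -(deriveE _ f2) e1 derive_id.
Qed.

Lemma velocity_wave (a w s : R) : velocity (wave a w) s = (- (a * w * sin (w * s)), 1).
Proof. by have [] := diff_wave a w s. Qed.

Lemma wave_C1 (a w : R) : C1_curve (wave a w).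
Proof.
split=> [s|]; first by have [] := diff_wave a w s.
rewrite (_ : velocity _ = fun s => (- (a * w * sin (w * s)), 1)); last first.
  by apply/funext => s; exact: velocity_wave.
have cx : continuous (fun s => - (a * w * sin (w * s))).
  move=> s; apply: cvgN; apply: cvgM; first exact: cvg_cst.
  apply: (@continuous_comp _ _ _ ( *%R w) (@sin R)); last exact: continuous_sin.
  by apply: cvgM; [exact: cvg_cst | exact: cvg_id].
by move=> s; exact: (cvg_pair (F := nbhs s) (cx s) (cvg_cst (1 : R))).
Qed.

(** N full periods on [0, 1], so that the curves are apart at both ends. *)
Definition frequency (N : nat) : R := pi *+ 2 * N%:R.

(** Remove multiples of pi, each of which changes the sign of the cosine, until
    the injectivity of the cosine on [0, pi] applies. *)
Lemma cos_eq0 (x : R) : 0 <= x -> cos x = 0 ->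
  x = pi * ((Num.truncn (x / pi))%:R + 2^-1).
Proof.
move=> x0 cx; have pi0 := pi_gt0 R.
have /truncn_itv /andP[h1 h2] : 0 <= x / pi by rewrite divr_ge0 // ltW.
set k := Num.truncn _ in h1 h2 *; rewrite ler_pdivlMr // ltr_pdivrMr // in h1 h2.
have e : x = (x - k%:R * pi) + pi *+ k by rewrite mulr_natl subrK.
rewrite e (alternatingn (@cosDpi R)) in cx.
have cy : cos (x - k%:R * pi) = cos (pi / 2).
  by rewrite cos_pihalf; move/eqP: cx; rewrite mulf_eq0 signr_eq0 => /eqP.
have i1 : x - k%:R * pi \in `[0, pi]%R.
  by rewrite in_itv /= subr_ge0 h1 lerBlDr; move: h2; rewrite -natr1; lra.
have i2 : (pi / 2 : R) \in `[0, pi]%R by rewrite in_itv /=; lra.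
have := cos_inj i1 i2 cy; lra.
Qed.

Lemma frequency_zeros_finite N : finite_set
    [set s : R | 0 <= s <= 1 /\ cos (frequency N * s) = 0].
Proof.
apply: (@sub_finite_set _ _
  ((fun k : nat => (k%:R + 2^-1) / (2 * N%:R)) @` `I_(2 * N).+1)).
  move=> s /= [/andP[s0 s1] cs].
  case: N cs => [|N] cs.
    by move: cs; rewrite /frequency mulr0 mul0r cos0 => /eqP; rewrite oner_eq0.
  have pi0 := pi_gt0 R.
  have f0 : 0 <= frequency N.+1 * s.
    by rewrite mulr_ge0 // /frequency mulr_ge0 // mulrn_wge0 // ltW.
  have := cos_eq0 f0 cs.
  have -> : frequency N.+1 * s / pi = 2 * N.+1%:R * s.
    have fE (P m u : R) : P != 0 -> P *+ 2 * m * u / P = 2 * m * u by move=> ?; field.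
    by rewrite /frequency fE // gt_eqF.
  have N0 : 0 < N.+1%:R :> R by rewrite ltr0n.
  move=> e; exists (Num.truncn (2 * N.+1%:R * s)).
    by rewrite /= ltnS truncn_le_nat -[X in _ < X]natr1 natrM; nra.
  have pin : pi != 0 :> R by rewrite gt_eqF.
  have e' : 2 * N.+1%:R * s = (Num.truncn (2 * N.+1%:R * s))%:R + 2^-1.
    by apply: (mulfI pin); rewrite -e /frequency; ring.
  by rewrite -e'; field; rewrite gt_eqF.
exact/finite_image/finite_II.
Qed.

End WaveTangles.

Section WaveTangle.
Variables (R : realType) (N : nat) (flip : nat -> bool) (line_over : nat -> bool).

Definition amplitude (i : 'I_2) : R := if i == ord0 then 0 else 4^-1.

(** The wave crosses the line twice in the j-th period, in opposite
    directions; [flip j] selects the crossing of that period which is classical,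
    and thereby its sign.  The other one is virtual. *)
Definition crossing_time (j : nat) : R :=
  (j%:R + (flip j : nat)%:R / 2 + 4^-1) / N%:R.

Definition strand_pt (i : 'I_2) (j : nat) : source R 2 := (i, crossing_time j).

Definition wave_crossing (j : nat) : source R 2 * source R 2 :=
  if line_over j then (strand_pt ord0 j, strand_pt ord_max j)
  else (strand_pt ord_max j, strand_pt ord0 j).

Definition wave_curve (i : 'I_2) : R -> R * R := wave (amplitude i) (frequency R N).

Lemma crossing_phase j : (j < N)%N ->
  frequency R N * crossing_time j = pi / 2 + pi *+ (flip j + j.*2).
Proof.
move=> jN; have N0 : N%:R != 0 :> R by rewrite pnatr_eq0 -lt0n (leq_ltn_trans _ jN).
have E (P m u : R) : m != 0 -> P *+ 2 * m * (u / m) = P * (2 * u) by move=> ?; field.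
rewrite /frequency /crossing_time E // -[pi *+ _]mulr_natr -mul2n natrD natrM.
by rewrite -mulrDr; congr (_ * _); field.
Qed.

Lemma cos_crossing j : (j < N)%N -> cos (frequency R N * crossing_time j) = 0.
Proof.
by move=> jN; rewrite crossing_phase // (alternatingn (@cosDpi R)) cos_pihalf mulr0.
Qed.

Lemma sin_crossing j : (j < N)%N ->
  sin (frequency R N * crossing_time j) = (-1) ^+ flip j.
Proof.
move=> jN; rewrite crossing_phase // (alternatingn (@sinDpi R)) sin_pihalf mulr1.
by rewrite exprD -mul2n exprM sqrrN expr1n expr1n mulr1.
Qed.

Lemma crossing_time_itv j : (j < N)%N -> 0 < crossing_time j < 1.
Proof.
move=> jN; have N0 : 0 < N%:R :> R by rewrite ltr0n (leq_ltn_trans _ jN).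
have j0 : 0 <= j%:R :> R by [].
have jN1 : j%:R + 1 <= N%:R :> R by rewrite natr1 ler_nat.
have fj : 0 <= ((flip j : nat)%:R : R) <= 1 by case: (flip j); rewrite /= ?ler01 ?lexx.
by rewrite /crossing_time divr_gt0 ?ltr_pdivrMr //; lra.
Qed.

Lemma crossing_time_inj i j : (0 < N)%N -> crossing_time i = crossing_time j -> i = j.
Proof.
move=> N0; have N0' : N%:R != 0 :> R by rewrite pnatr_eq0 -lt0n.
move=> /(mulIf (invr_neq0 N0')) e.
have f01 k : 0 <= ((flip k : nat)%:R : R) <= 1 by case: (flip _); rewrite /= ?ler01 ?lexx.
have fi := f01 i; have fj := f01 j.
apply/eqP; rewrite eqn_leq; apply/andP; split; rewrite leqNgt; apply/negP => h.
  have : j%:R + 1 <= i%:R :> R by rewrite natr1 ler_nat.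
  by lra.
have : i%:R + 1 <= j%:R :> R by rewrite natr1 ler_nat.
by lra.
Qed.

Lemma amplitude_inj i j : amplitude i = amplitude j -> i = j.
Proof.
rewrite /amplitude; case: (eqVneq i ord0) => [->|i0]; case: (eqVneq j ord0) => [->|j0] //.
- by move=> e; exfalso; lra.
- by move=> e; exfalso; lra.
move=> _; apply: val_inj => /=.
by case: i j i0 j0 => -[|[|//]] ? [[|[|//]] ?].
Qed.

Let long2 : 'I_2 -> bool := fun=> false.

Lemma wave_doubleE (p q : source R 2) : double_pt long2 wave_curve p q <->
  [/\ 0 <= p.2 <= 1, p.2 = q.2, p.1 <> q.1 & cos (frequency R N * p.2) = 0].
Proof.
split; case: p q => [i s] [j t] /=.
  case=> -[/= s0 s1] _ pq [/addrI e st]; rewrite -st in e pq *.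
  have ij : i <> j by move=> ij; apply: pq; rewrite ij.
  split=> //; first by rewrite s0.
  apply/eqP; apply: contra_notT ij => c0; apply: amplitude_inj.
  exact: mulIf c0 _ _ e.
move=> [/andP[s0 s1] st ij c0]; rewrite -st.
split=> //=; first by case=> /ij.
by rewrite /wave_curve /wave /= c0 !mulr0.
Qed.

Lemma frequency_cos_ends (s : R) : s = 0 \/ s = 1 -> cos (frequency R N * s) = 1.
Proof.
have E : frequency R N = 0 + pi *+ N.*2 by rewrite /frequency add0r -mul2n mulrnA mulr_natr.
case=> ->; first by rewrite mulr0 cos0.
by rewrite mulr1 E (alternatingn (@cosDpi R)) cos0 -mul2n exprM sqrrN !expr1n mulr1.
Qed.

Lemma wave_open_square i (s : R) : 0 < s < 1 -> open_square (wave_curve i s).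
Proof.
move=> s01; split=> //=; have := cos_geN1 (frequency R N * s).
have := cos_le1 (frequency R N * s).
by rewrite /amplitude; case: ifP => _; move: (cos _) => c *; lra.
Qed.

Lemma wave_double_interior (p q : source R 2) : double_pt long2 wave_curve p q ->
  0 < p.2 < 1.
Proof.
move=> /wave_doubleE [/andP[p0 p1] _ _ c0].
rewrite !lt_neqAle p0 p1 !andbT; apply/andP; split; apply/eqP => e;
  move: c0; rewrite frequency_cos_ends; try by [left | right];
  by move=> /eqP; rewrite oner_eq0.
Qed.

Definition wave_over : set (source R 2 * source R 2) :=
  wave_crossing @` `I_N.

Lemma wave_over_double p q : wave_over (p, q) -> double_pt long2 wave_curve p q.
Proof.
case=> j jN; have /andP[t0 t1] := crossing_time_itv jN.
by rewrite /wave_crossing; case: (line_over j) => -[<- <-]; apply/wave_doubleE;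
  split; rewrite //= ?cos_crossing ?ltW.
Qed.

Lemma wave_over_asym p q : wave_over (p, q) -> ~ wave_over (q, p).
Proof.
move=> [i iN ei] [j jN ej].
have et : crossing_time i = crossing_time j.
  have -> : crossing_time i = p.2.
    by move: ei; rewrite /wave_crossing; case: ifP => _ [<- _].
  by move: ej; rewrite /wave_crossing; case: ifP => _ [_ <-].
have eij := crossing_time_inj (leq_ltn_trans (leq0n _) iN) et.
rewrite -eij ei in ej.
have pq : p <> q by have [] := wave_over_double (ex_intro2 _ _ i iN ei).
by case: ej => /pq.
Qed.

Lemma wave_transverse p q : double_pt long2 wave_curve p q ->
  det2 (velocity (wave_curve p.1) p.2) (velocity (wave_curve q.1) q.2) != 0.
Proof.
move=> /wave_doubleE [_ st ij c0]; rewrite !velocity_wave -st /det2 /=.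
have s0 : sin (frequency R N * p.2) != 0.
  apply/eqP => s0; have := cos2Dsin2 (frequency R N * p.2).
  by rewrite c0 s0 expr0n addr0 => /eqP; rewrite eq_sym oner_eq0.
have w0 : frequency R N != 0.
  by apply/eqP => w0; move: c0; rewrite w0 mul0r cos0 => /eqP; rewrite oner_eq0.
have a0 : amplitude q.1 - amplitude p.1 != 0.
  by apply/eqP => /subr0_eq /amplitude_inj /esym.
have E (a b w s : R) : - (a * w * s) * 1 - 1 * - (b * w * s) = (b - a) * w * s.
  by ring.
rewrite E; apply: mulf_neq0 s0; exact: mulf_neq0 a0 w0.
Qed.

Lemma wave_no_triple p q r : double_pt long2 wave_curve p q ->
  double_pt long2 wave_curve p r -> q = r.
Proof.
move=> /wave_doubleE [_ sq pq _] /wave_doubleE [_ sr pr _].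
apply: injective_projections; last by rewrite -sq.
have vpq : (p.1 : nat) <> q.1 by move=> e; apply: pq; exact: val_inj.
have vpr : (p.1 : nat) <> r.1 by move=> e; apply: pr; exact: val_inj.
apply: val_inj => /=; have := ltn_ord p.1; have := ltn_ord q.1.
by have := ltn_ord r.1; lia.
Qed.

Lemma wave_double_finite :
  finite_set [set c | double_pt long2 wave_curve c.1 c.2].
Proof.
have fin := frequency_zeros_finite R N.
have fI : finite_set [set: 'I_2 * 'I_2] by exact: finite_finset.
apply: sub_finite_set (finite_image (fun x => ((x.1.1, x.2), (x.1.2, x.2)))
  (finite_setX fI fin)).
move=> [[i s] [j t]] /wave_doubleE /= [s01 st _ c0].
by exists ((i, j), s); [split | rewrite /= st].
Qed.

Definition wave_tangle : diagram R 2.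
Proof.
refine (@Diagram R 2 long2 wave_curve wave_over
  _ _ _ _ _ _ wave_double_finite wave_transverse wave_no_triple
  wave_over_double wave_over_asym) => //.
- by move=> i; exact: wave_C1.
- by move=> i s _; rewrite velocity_wave; apply/eqP => -[_ /eqP]; rewrite oner_eq0.
- by move=> i s _ [//|]; exact: wave_open_square.
- move=> i s _ s01; rewrite velocity_wave /= oner_neq0; split=> //.
  rewrite /wave_curve /wave /top_bottom /= frequency_cos_ends //; split=> //.
  by rewrite /amplitude; case: ifP => _; lra.
- by move=> p q /wave_double_interior; exact: wave_open_square.
Defined.

End WaveTangle.

Section Linking.
Variables (R : realType).

Lemma fsum_wave N flip line_over (G : source R 2 * source R 2 -> int) :
  \sum_(c \in over (wave_tangle R N flip line_over)) G c =
  \sum_(j < N) G (wave_crossing R N flip line_over j).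
Proof.
apply: etrans _ (esym (fsbig_ord _ _ (fun j => G (wave_crossing R N flip line_over j)))).
apply: fsbig_image => i j; rewrite !inE /= => iN jN e.
apply: (@crossing_time_inj R N flip); first exact: leq_ltn_trans iN.
move: e; rewrite /wave_crossing.
by case: (line_over i); case: (line_over j) => -[].
Qed.

Lemma csgn_wave N flip line_over j : (j < N)%N ->
  csgn (wave_tangle R N flip line_over)
    (strand_pt R N flip ord0 j) (strand_pt R N flip ord_max j) = (-1) ^+ flip j.
Proof.
move=> jN; rewrite /csgn /dir /= !velocity_wave sin_crossing // /det2 /=.
have E (a b w s : R) : - (a * w * s) * 1 - 1 * - (b * w * s) = (b - a) * w * s by ring.
have w0 : 0 < frequency R N.
  by rewrite mulr_gt0 ?ltr0n ?(leq_ltn_trans _ jN) // pmulrn_lgt0 ?pi_gt0.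
have q0 : 0 < 4^-1 :> R by rewrite invr_gt0.
rewrite E /amplitude /= subr0 sgzM (sgzM 4^-1) (gtr0_sgz w0) (gtr0_sgz q0) !mul1r.
by case: (flip j); rewrite ?expr1 ?expr0 ?sgzN sgz1.
Qed.

Lemma vlk_wave01 N flip line_over :
  vlk (wave_tangle R N flip line_over) ord0 ord_max =
  \sum_(j < N) (if line_over j then (-1) ^+ flip j else 0).
Proof.
apply: etrans (fsum_components _ _ _ _) _; apply: etrans (fsum_wave _ _ _ _) _.
apply: eq_bigr => j _; rewrite /wave_crossing.
by case: (line_over j) => //=; rewrite csgn_wave.
Qed.

Lemma vlk_wave10 N flip line_over :
  vlk (wave_tangle R N flip line_over) ord_max ord0 =
  \sum_(j < N) (if line_over j then 0 else - (-1) ^+ flip j).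
Proof.
apply: etrans (fsum_components _ _ _ _) _; apply: etrans (fsum_wave _ _ _ _) _.
apply: eq_bigr => j _; rewrite /wave_crossing.
by case: (line_over j) => //=; rewrite csgnC csgn_wave.
Qed.

Lemma sum_sgz (p : int) : \sum_(j < `|p|) sgz p = p.
Proof. by rewrite sumr_const card_ord -mulr_natr natz -intEsg. Qed.

(** The first |p| periods contribute to one linking number and the next |q| to
    the other, each with the sign required; passing under instead of over
    reverses the sign of the crossing, hence the two conventions for the flip. *)
Lemma realize_linking (p q : int) : exists D : diagram R 2,
  [/\ long D, forall c, over D c -> c.1.1 != c.2.1,
      vlk D ord0 ord_max = p & vlk D ord_max ord0 = q].
Proof.
pose N := (`|p| + `|q|)%N; pose u j := (j < `|p|)%N.
pose e j := if u j then p < 0 else 0 < q.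
exists (wave_tangle R N e u); split=> //.
- by case=> x y [j _]; rewrite /wave_crossing; case: (u j) => -[<- <-].
- rewrite vlk_wave01 big_split_ord /= addrC big1 ?add0r => [|j _]; last first.
    by rewrite /u ltnNge leq_addr.
  rewrite -[RHS]sum_sgz; apply: eq_bigr => j _; rewrite /e /u ltn_ord.
  have [p0|p0|p0] := ltrgt0P p; last by have := ltn_ord j; lia.
    by rewrite (gtr0_sgz p0).
  by rewrite (ltr0_sgz p0).
- rewrite vlk_wave10 big_split_ord /= big1 ?add0r => [|j _]; last by rewrite /u ltn_ord.
  rewrite -[RHS]sum_sgz; apply: eq_bigr => j _; rewrite /e /u ltnNge leq_addr /=.
  have [q0|q0|q0] := ltrgt0P q; last by have := ltn_ord j; lia.
    by rewrite (gtr0_sgz q0) opprK.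
  by rewrite (ltr0_sgz q0).
Qed.

End Linking.

(** * Comparing the polynomials *)

Section Tangles.
Variable R : realType.

Definition tangle_of (D : diagram R 2) : vtangle R :=
  existT _ 2 (\pi_(vtangle_of R 2)%qT D).

Lemma equivalent_repr (D : diagram R 2) :
  equivalent D (repr (\pi_(vtangle_of R 2)%qT D)).
Proof. by apply/eqmodP; exact/esym/reprK. Qed.

Lemma diag_psc0 (D : diagram R 2) :
  (forall c, over D c -> c.1.1 != c.2.1) -> diag_psc D = 0.
Proof.
move=> nself; rewrite diag_pscE; apply: fsbig1 => c oc.
by rewrite (negPf (nself c oc)).
Qed.

Lemma realize_tangle (p q : int) : exists T : vtangle R,
  [/\ psc T = 0,
      forall a b, plk a b T = (a * p%:~R + b * q%:~R) *: monomial (expo 0 1 + expo 1 1) &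
      forall a b, plkL a b T = (a * p%:~R) *: monomial (expo 0 1 + expo 1 (-1)) +
                               (b * q%:~R) *: monomial (expo 0 (-1) + expo 1 1)].
Proof.
have [D [lD nself Dp Dq]] := realize_linking R p q.
have eD := equivalent_repr D.
have s0 : diag_psc (repr (\pi_(vtangle_of R 2)%qT D)) = 0.
  by rewrite -(psc_equivalent lD eD) diag_psc0.
have n01 : (ord0 : 'I_2) != ord_max by [].
have n10 : (ord_max : 'I_2) != ord0 by [].
have v01 := vlk_equivalent n01 lD eD.
have v10 := vlk_equivalent n10 lD eD.
have sum2 (G : 'I_2 -> 'I_2 -> laurent) :
    \sum_(i < 2) \sum_(j < 2 | (i < j)%N) G i j = G ord0 ord_max.
  rewrite big_ord_recl big_ord1 (big_pred1 ord_max) => [|j]; last first.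
    by case: j => -[|[|//]].
  have no (j : 'I_2) : (lift (ord0 : 'I_2) ord0 < j)%N = false by case: j => -[|[|//]].
  by rewrite (eq_bigl _ _ no) big_pred0_eq addr0.
exists (tangle_of D); split=> [|a b|a b].
- exact: s0.
- by rewrite /plk /diag_plk s0 add0r sum2 -v01 -v10 Dp Dq.
- by rewrite /plkL /diag_plkL s0 add0r sum2 -v01 -v10 Dp Dq.
Qed.

Lemma mcoeff_monomial (u v : exponents) (x : rat) :
  mcoeff v (x *: monomial u) = if u == v then x else 0.
Proof.
rewrite mcoeffZ mcoeffU; case: eqP => _; by rewrite ?mulr1n ?mulr0n ?mulr1 ?mulr0.
Qed.

Lemma monomial_indep (u v : exponents) (x y x' y' : rat) : u != v ->
  x *: monomial u + y *: monomial v = x' *: monomial u + y' *: monomial v ->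
  x = x' /\ y = y'.
Proof.
move=> /negPf uv e.
have C w (s t : rat) : mcoeff w (s *: monomial u + t *: monomial v) =
    (if u == w then s else 0) + (if v == w then t else 0).
  apply: etrans (mcoeffD _ _ _) _.
  exact: congr2 (mcoeff_monomial _ _ _) (mcoeff_monomial _ _ _).
have E w := etrans (esym (C w x y)) (etrans (congr1 (mcoeff w) e) (C w x' y')).
have Eu := E u; have Ev := E v; rewrite eqxx (eq_sym v u) uv !addr0 in Eu.
rewrite eqxx uv !add0r in Ev; exact: conj Eu Ev.
Qed.

Lemma linking_exponents_neq :
  (expo 0 1 + expo 1 (-1) : exponents) != expo 0 (-1) + expo 1 1.
Proof.
by apply/eqP => /(congr1 (mcoeff 0%N)); rewrite !mcoeffD !mcoeff_expo.
Qed.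

Lemma plk_determines_psc a b (T T' : vtangle R) :
  plk a b T = plk a b T' -> psc T = psc T'.
Proof.
rewrite /plk /psc => e; apply/malgP => m.
apply: etrans (psc_of_plk _ a b m) _; apply: etrans _ (esym (psc_of_plk _ a b m)).
exact: (congr1 (fun x => lincoef drop_mixed m x) e).
Qed.

Lemma plkL_determines_plk a b (T T' : vtangle R) :
  plkL a b T = plkL a b T' -> plk a b T = plk a b T'.
Proof.
rewrite /plk /plkL => e; apply/malgP => m.
apply: etrans (plk_of_plkL _ a b m) _; apply: etrans _ (esym (plk_of_plkL _ a b m)).
exact: (congr1 (fun x => lincoef (monomial \o abs_exponents) m x) e).
Qed.

Lemma monomial_scale_inj (u : exponents) (x y : rat) :
  x *: monomial u = y *: monomial u -> x = y.
Proof.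
move=> e; have := etrans (esym (mcoeff_monomial u u x))
  (etrans (congr1 (mcoeff u) e) (mcoeff_monomial u u y)).
by rewrite eqxx.
Qed.

Lemma separate_plk (a b : rat) : a != 0 \/ b != 0 -> exists T1 T2 : vtangle R,
  psc T1 = psc T2 /\ plk a b T1 <> plk a b T2.
Proof.
move=> ab0; have [T0 [s0 l0 _]] := realize_tangle 0 0.
have [p [q /eqP pq]] : exists p q : int, a * p%:~R + b * q%:~R != 0.
  case: ab0 => [a0|b0]; first by exists 1, 0; rewrite mulr1z mulr0z mulr1 mulr0 addr0.
  by exists 0, 1; rewrite mulr1z mulr0z mulr1 mulr0 add0r.
have [T [s l _]] := realize_tangle p q.
exists T, T0; split=> [|e]; first exact: etrans s (esym s0).
have := monomial_scale_inj (etrans (esym (l a b)) (etrans e (l0 a b))).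
by rewrite mulr0z !mulr0 addr0.
Qed.

(** Clearing denominators in a / b gives nonzero integers p and q with
    a p + b q = 0. *)
Lemma separate_plkL (a b : rat) : a != 0 -> b != 0 -> exists T1 T2 : vtangle R,
  plk a b T1 = plk a b T2 /\ plkL a b T1 <> plkL a b T2.
Proof.
move=> a0 b0; have [T0 [_ l0 L0]] := realize_tangle 0 0.
have [T [_ l L]] := realize_tangle (numq b * denq a) (- (numq a * denq b)).
exists T, T0; split=> [|e].
  apply: etrans (l a b) _; apply: etrans _ (esym (l0 a b)).
  suff E : a * (numq b * denq a)%:~R + b * (- (numq a * denq b))%:~R =
      a * 0%:~R + b * 0%:~R by exact: (congr1 (fun x : rat => x *: monomial _) E).
  rewrite mulr0z !mulr0 addr0 rmorphN /= !intrM !numqE.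
  move: (denq a)%:~R (denq b)%:~R => x y; ring.
have [/eqP + _] := monomial_indep linking_exponents_neq
  (etrans (esym (L a b)) (etrans e (L0 a b))).
by rewrite mulr0z mulr0 mulf_eq0 (negPf a0) intr_eq0 mulf_eq0 numq_eq0 denq_eq0 (negPf b0).
Qed.

End Tangles.

Theorem proposition3p2p1 (R : realType) (a b : rat) :
  (a != 0 \/ b != 0 ->
     stronger (@plk R a b) (@psc R) /\ stronger (@plkL R a b) (@psc R)) /\
  (a != 0 /\ b != 0 -> stronger (@plkL R a b) (@plk R a b)).
Proof.
split=> [ab0|[a0 b0]].
  have [T1 [T2 [es el]]] := separate_plk R ab0.
  split; split=> [K K' e|].
  - exact: plk_determines_psc e.
  - by exists T1, T2.
  - exact: plk_determines_psc (plkL_determines_plk e).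
  - by exists T1, T2; split=> // /plkL_determines_plk.
split=> [K K'|]; [exact: plkL_determines_plk | exact: separate_plkL].
Qed.
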